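(* Let $n,d\in\mathbb{N}$ and consider functions $f:[n]^d\to\mathbb{R}$ and a distance parameter $\varepsilon\in(0,1/2)$. (1) There is a nonadaptive unateness tester for such functions that makes $O\!\left(\frac{d}{\varepsilon}\left(\log\frac{d}{\varepsilon}+\log n\right)\right)$ queries. (2) There is an adaptive unateness tester for such functions that makes $O\!\left(\frac{d\log n}{\varepsilon}\right)$ queries. Both testers have one-sided error.
   Context: A function $f:[n]^d\to\mathbb{R}$ is unate if for every coordinate $i\in[d]$, $f$ is either nonincreasing in the $i$-th coordinate or nondecreasing in the $i$-th coordinate (with the other coordinates fixed). $f$ is $\varepsilon$-far from unate if at least an $\varepsilon$ fraction of the values of $f$ must be modified to make it unate. A unateness tester gets $\varepsilon$ and query access to $f$; it must accept with probability at least $2/3$ if $f$ is unate and reject with probability at least $2/3$ if $f$ is $\varepsilon$-far from unate. It has one-sided error if it always accepts unate functions. A nonadaptive tester chooses all its queries before seeing any answers; an adaptive tester may choose queries based on previous answers. *)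

(* Defs.v *)
From mathcomp Require Import all_boot all_order all_algebra.
From mathcomp Require Import reals.
Set Implicit Arguments.
Unset Strict Implicit.
Unset Printing Implicit Defensive.

Import Order.TTheory GRing.Theory Num.Theory.
Local Open Scope ring_scope.

(* [n]^d; the chain 'I_n = {0 < ... < n-1} stands for {1 < ... < n}. *)
Definition grid (n d : nat) := {ffun 'I_d -> 'I_n}.

Section Unateness.
Variables (R : realType) (n d : nat).
Implicit Types (f g : grid n d -> R) (i : 'I_d) (eps : R).

Definition differ_only_at i (x y : grid n d) := forall j, j != i -> x j = y j.

Definition nondecreasing_in i f :=
  forall x y, differ_only_at i x y -> (x i <= y i)%N -> f x <= f y.

Definition nonincreasing_in i f :=
  forall x y, differ_only_at i x y -> (x i <= y i)%N -> f y <= f x.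

Definition unate f := forall i, nonincreasing_in i f \/ nondecreasing_in i f.

Definition hamming_dist f g : R :=
  #|[set x | f x != g x]|%:R / #|{: grid n d}|%:R.

Definition far_from_unate eps f := forall g, unate g -> eps <= hamming_dist f g.

End Unateness.

(* A deterministic query algorithm is a decision tree: each internal node
   queries a point and continues according to the answer; a leaf accepts
   ([true]) or rejects ([false]). *)
Inductive dtree (X A : Type) : Type :=
| Leaf of bool
| Query of X & (A -> dtree X A).

Fixpoint accepts (X A : Type) (t : dtree X A) (f : X -> A) : bool :=
  match t with
  | Leaf b => b
  | Query x k => accepts (k (f x)) f
  end.

(* The points queried on input [f], in order and with repetitions. *)
Fixpoint queries (X A : Type) (t : dtree X A) (f : X -> A) : seq X :=
  match t with
  | Leaf _ => [::]
  | Query x k => x :: queries (k (f x)) f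
  end.

(* A randomized query algorithm is a probability distribution on deterministic
   ones: the random seed is drawn before the first query. *)
Record tester (R : realType) (n d : nat) := Tester {
  seed : finType;
  weight : seed -> R;
  weight_ge0 : forall s, 0 <= weight s;
  weight_sum1 : \sum_s weight s = 1;
  algo : seed -> dtree (grid n d) R
}.

Section Testers.
Variables (R : realType) (n d : nat).
Implicit Types (T : tester R n d) (f : grid n d -> R) (eps : R).

Definition pr T (E : pred (seed T)) : R := \sum_(s | E s) weight s.

Definition unateness_tester eps T :=
  (forall f, unate f -> 2 / 3 <= pr (fun s : seed T => accepts (algo s) f)) /\
  (forall f, far_from_unate eps f ->
     2 / 3 <= pr (fun s : seed T => ~~ accepts (algo s) f)).

Definition one_sided_error T :=
  forall f, unate f -> forall s : seed T, accepts (algo s) f.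

(* Once the seed is drawn, the query list is the same for all inputs. *)
Definition nonadaptive T :=
  forall s : seed T, exists qs : seq (grid n d),
    forall f, queries (algo s) f = qs.

(* Worst case over the inputs and the seeds; the bound is a real number. *)
Definition query_bound T (q : R) :=
  forall (s : seed T) f, (size (queries (algo s) f))%:R <= q.

End Testers.

(* Main.v *)
(* A function far from unate is repaired coordinate by coordinate. Let Z_i be
   a set of points off which f is monotone along the i-lines (in a direction
   chosen for each i); then f is within 4 * sum_i |Z_i| changes of a unate
   function. For Boolean f one sorts all lines, one direction after another:
   sorting the i-lines does not increase Hamming distances and keeps
   monotonicity in the other directions. For real f, take an L1-nearest
   monotone h to the ranks of f; on each level set h = c, minimality makes a
   constant the nearest monotone function to the thresholds of f at c, so the
   Boolean case applies on each level set separately.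

   On a line, compare a random point x with the O(log n) dyadic points around
   it ("path"), the middle of the line, and a random point w of the line. If
   the path together with w rarely both rises and falls, and the pair (x, w)
   rarely rises, then few points need to be removed to make the line
   nonincreasing. So, if f is eps-far from unate, then the probability that
   the path both rises and falls, plus the smaller of the probabilities that a
   pair rises or falls, sums over the directions to at least eps / 16. The
   first event is caught by O(d / eps) paths. The second one requires a rise
   and a fall among pairs, which cost two queries each: nonadaptively by
   guessing the scale of the smaller probability (Levin's work investment),
   adaptively by looking for a second nonconstant pair only after a first one
   has been found, which costs O(1) on average. *)
Require Import Defs.
From mathcomp Require Import all_boot all_order all_algebra.
From mathcomp Require Import boolp reals exp.
From mathcomp Require Import zify ring lra.
Set Implicit Arguments.
Unset Strict Implicit.
Unset Printing Implicit Defensive.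
Import Order.TTheory GRing.Theory Num.Theory.

(** * Boolean functions and nearest monotone functions *)

Section Grid.
Variables n d : nat.
Implicit Types (x y : grid n d) (i j : 'I_d) (v w : 'I_n).

Definition upd x i v : grid n d := [ffun j => if j == i then v else x j].

Lemma updE x i v : upd x i v i = v.
Proof. by rewrite ffunE eqxx. Qed.

Lemma upd_neq x i j v : j != i -> upd x i v j = x j.
Proof. by rewrite ffunE => /negbTE->. Qed.

Lemma upd_upd x i v w : upd (upd x i v) i w = upd x i w.
Proof. by apply/ffunP => j; rewrite !ffunE; case: (j == i). Qed.

Lemma upd_id x i : upd x i (x i) = x.
Proof. by apply/ffunP => j; rewrite !ffunE; case: eqP => [->|]. Qed.

Lemma updC x i j v w : i != j -> upd (upd x i v) j w = upd (upd x j w) i v.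
Proof.
move=> ij; apply/ffunP => k; rewrite !ffunE.
by case: (eqVneq k j) => [->|//]; rewrite eq_sym (negbTE ij).
Qed.

(** Exchanging the free value with the current [i]-th coordinate is an involution on pairs of a
    point and a value, so every point is reached exactly [n] times. *)
Lemma sum_lines i (F : grid n d -> nat) :
  \sum_x \sum_v F (upd x i v) = n * \sum_x F x.
Proof.
pose swap (p : grid n d * 'I_n) := (upd p.1 i p.2, p.1 i).
have swapK : involutive swap.
  by move=> [x v]; rewrite /swap /= upd_upd upd_id updE.
rewrite pair_big /= [LHS](eq_bigr (fun p => F (swap p).1)) //.
rewrite -(reindex swap (P := xpredT) (F := fun p => F p.1)); last first.
  by apply: onW_bij; exists swap.
rewrite -(pair_big xpredT xpredT (fun x _ => F x)) /= big_distrr /=.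
by apply: eq_bigr => x _; rewrite sum_nat_const card_ord.
Qed.

Definition hdist (T : eqType) (f g : grid n d -> T) := \sum_x (f x != g x).

Lemma hdistC (T : eqType) (f g : grid n d -> T) : hdist f g = hdist g f.
Proof. by apply: eq_bigr => x _; rewrite eq_sym. Qed.

Lemma hdist_triangle (T : eqType) (g f h : grid n d -> T) :
  hdist f h <= hdist f g + hdist g h.
Proof.
rewrite -big_split leq_sum // => x _ /=.
by case: (eqVneq (f x) (g x)) => [->|_]; case: (_ != _).
Qed.

(** * Sorting Boolean functions along lines *)

Section BooleanSorting.
Implicit Types b u : grid n d -> bool.

Definition incr_in i b := forall x v w, v <= w -> b (upd x i v) -> b (upd x i w).

Definition ones i b x := \sum_v b (upd x i v).

(** A line with [k] ones gets its ones in the last [k] positions; the additive form avoids truncated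
    subtraction. *)
Definition sort_in i b x := n <= x i + ones i b x.

Lemma ones_upd i b x v : ones i b (upd x i v) = ones i b x.
Proof. by apply: eq_bigr => w _; rewrite upd_upd. Qed.

Lemma ones_le i b x : ones i b x <= n.
Proof.
rewrite -[leqRHS]card_ord -sum1_card leq_sum // => v _.
exact: leq_b1.
Qed.

Lemma sum_geq k : k <= n -> \sum_(v < n) (k <= v : nat) = n - k.
Proof.
move=> kn; rewrite -(big_mkord xpredT (fun m => (k <= m : nat))).
rewrite (big_cat_nat (n := k)) //= big_nat big1 ?add0n; last first.
  by move=> v /andP[_]; rewrite ltnNge => /negbTE->.
rewrite big_nat (eq_bigr (fun=> 1)); last by move=> v /andP[->].
by rewrite -big_nat sum_nat_const_nat muln1.
Qed.

Lemma sort_in_incr i b : incr_in i (sort_in i b).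
Proof. by move=> x v w vw; rewrite /sort_in !ones_upd !updE; lia. Qed.

(** For [j != i], raising the [j]-th coordinate keeps [x i] and cannot lose ones on the [i]-line. *)
Lemma sort_in_preserves i j b : incr_in j b -> incr_in j (sort_in i b).
Proof.
case: (eqVneq j i) => [-> _|ji bj]; first exact: sort_in_incr.
move=> x v w vw; rewrite /sort_in !upd_neq 1?eq_sym // => /leq_trans; apply.
rewrite leq_add2l leq_sum // => k _.
rewrite !(updC x _ k ji); have := bj (upd x i k) _ _ vw.
by case: (b _) => // ->.
Qed.

Lemma sort_in_id i b : incr_in i b -> sort_in i b =1 b.
Proof.
move=> bi x; rewrite /sort_in; case bx: (b x).
  suff : n - x i <= ones i b x by lia.
  rewrite -sum_geq ?(ltnW (ltn_ord _)) // leq_sum // => v _.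
  by case: (leqP (x i) v) => // vx; rewrite (bi _ _ _ vx) // upd_id.
suff : ones i b x <= n - (x i).+1 by have := ltn_ord (x i); lia.
rewrite -sum_geq // leq_sum // => v _; case: (ltnP (x i) v) => [_|vx]; first exact: leq_b1.
by case bv: (b _) => //; have := bi _ _ _ vx bv; rewrite upd_id bx.
Qed.

(** Two sorted lines with [p] and [q] ones are nested and differ in |p - q| places; the sum of the
    two truncated differences is this absolute value. *)
Lemma sum_shift_neq p q : p <= n -> q <= n ->
  \sum_(v < n) ((n <= v + p) != (n <= v + q) : nat) = (p - q) + (q - p).
Proof.
wlog pq : p q / p <= q => [hw pn qn|pn qn].
  case/orP: (leq_total p q) => ?; first exact: hw.
  by rewrite addnC -hw //; apply: eq_bigr => v _; rewrite eq_sym.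
have e v : ((n <= v + p) != (n <= v + q) : nat) + (n - p <= v) = (n - q <= v).
  by rewrite !leq_subLR !(addnC _ v);
     case: (leqP n (v + p)); case: (leqP n (v + q)) => //=; lia.
suff : \sum_(v < n) ((n <= v + p) != (n <= v + q) : nat) + (n - (n - p)) = n - (n - q).
  lia.
rewrite -[n - (n - p)]sum_geq ?leq_subr // -[n - (n - q)]sum_geq ?leq_subr //.
by rewrite -big_split; apply: eq_bigr => v _; exact: e.
Qed.

Lemma sum_dist (I : finType) (F G : I -> nat) :
  (\sum_k F k - \sum_k G k) + (\sum_k G k - \sum_k F k)
    <= \sum_k ((F k - G k) + (G k - F k)).
Proof.
have h (F' G' : I -> nat) : \sum_k F' k <= \sum_k G' k + \sum_k ((F' k - G' k) + (G' k - F' k)).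
  by rewrite -big_split leq_sum // => k _ /=; lia.
have e : \sum_k ((G k - F k) + (F k - G k)) = \sum_k ((F k - G k) + (G k - F k)).
  by apply: eq_bigr => k _; rewrite addnC.
by have := h F G; have := h G F; rewrite e; lia.
Qed.

(** Line by line: after sorting, two lines differ in as many places as their numbers of ones differ,
    and before sorting in at least that many. *)
Lemma sort_in_contract i b u : 0 < n -> hdist (sort_in i b) (sort_in i u) <= hdist b u.
Proof.
move=> n0; rewrite -(leq_pmul2l n0) -!(sum_lines i) leq_sum // => x _.
rewrite (eq_bigr (fun v : 'I_n => ((n <= v + ones i b x) != (n <= v + ones i u x) : nat))).
  rewrite sum_shift_neq ?ones_le //; apply: leq_trans (sum_dist _ _) _.
  by rewrite leq_sum // => v _; case: (b _); case: (u _).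
by move=> v _; rewrite /sort_in !ones_upd !updE.
Qed.

(** Sort [b] in all directions successively. A further sort along [i] moves [S b s] by at most twice
    [hdist b (u i)]: pass through [S (u i) s], which is still increasing in [i] and hence fixed by
    that sort, and use contraction on both sides of it. *)
Lemma boolean_dimension_reduction b (u : 'I_d -> grid n d -> bool) : 0 < n ->
  (forall i, incr_in i (u i)) ->
  exists2 g, forall i, incr_in i g & hdist b g <= 2 * \sum_i hdist b (u i).
Proof.
move=> n0 ui; pose S (a : grid n d -> bool) (s : seq 'I_d) := foldr sort_in a s.
have Sj s j a : incr_in j a -> incr_in j (S a s).
  by move=> aj; elim: s => //= i s; exact: sort_in_preserves.
have Ss s a j : j \in s -> incr_in j (S a s).
  elim: s => //= i s IH; rewrite inE => /predU1P[->|/IH]; first exact: sort_in_incr.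
  exact: sort_in_preserves.
have Sc s a a' : hdist (S a s) (S a' s) <= hdist a a'.
  by elim: s => //= i s; apply: leq_trans; exact: sort_in_contract.
exists (S b (enum 'I_d)) => [i|]; first by apply: Ss; rewrite mem_enum.
rewrite -big_enum /=; elim: (enum 'I_d) => [|i s IH].
  by rewrite big_nil /hdist big1 // => x _; rewrite eqxx.
rewrite big_cons; apply: leq_trans (hdist_triangle (S b s) _ _) _.
rewrite mulnDr addnC leq_add // mul2n -addnn.
apply: leq_trans (hdist_triangle (S (u i) s) _ _) (leq_add (Sc _ _ _) _).
have e : sort_in i (S (u i) s) =1 S (u i) s by apply/sort_in_id/Sj.
have -> : hdist (S (u i) s) (S b (i :: s)) = hdist (sort_in i (S (u i) s)) (S b (i :: s)).
  by apply: eq_bigr => x _; rewrite e.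
by rewrite hdistC; apply: leq_trans (sort_in_contract _ _ _ n0) (Sc _ _ _).
Qed.

(** The witness is the upward closure, along each [i]-line, of the ones of [b] off [Z]; off [Z] it
    agrees with [b]. *)
Lemma incr_in_completion i b (Z : {set grid n d}) :
  (forall x v w, v <= w -> upd x i v \notin Z -> upd x i w \notin Z ->
     b (upd x i v) -> b (upd x i w)) ->
  exists2 u, incr_in i u & hdist b u <= #|Z|.
Proof.
move=> bZ; exists (fun x => [exists v : 'I_n, [&& v <= x i, upd x i v \notin Z & b (upd x i v)]]).
  move=> x v w vw /existsP[k]; rewrite !upd_upd updE => /and3P[kv kZ bk].
  by apply/existsP; exists k; rewrite !upd_upd updE (leq_trans kv vw) kZ.
rewrite -sum1_card big_mkcond leq_sum // => x _.
case: (boolP (x \in Z)) => [_|xZ]; first exact: leq_b1.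
suff -> : [exists v : 'I_n, [&& v <= x i, upd x i v \notin Z & b (upd x i v)]] = b x.
  by rewrite eqxx.
apply/existsP/idP => [[v /and3P[vx vZ bv]]|bx].
  by have := bZ x v (x i) vx; rewrite upd_id; apply.
by exists (x i); rewrite leqnn upd_id xZ.
Qed.

End BooleanSorting.

(** * Minimality of an L1-nearest monotone function on its level sets *)

Section NearestMonotone.
Implicit Types (r h : grid n d -> nat).

Definition incr_natfun h := forall i x v w, v <= w -> h (upd x i v) <= h (upd x i w).

Definition l1dist r h := \sum_x ((r x - h x) + (h x - r x)).

Lemma exists_l1_nearest r : exists2 h, incr_natfun h &
  forall h', incr_natfun h' -> l1dist r h <= l1dist r h'.
Proof.
pose P k := `[< exists2 h, incr_natfun h & l1dist r h = k >].
have exP : exists k, P k.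
  by exists (l1dist r (fun=> 0)); apply/asboolP; exists (fun=> 0).
case: (ex_minnP exP) => k /asboolP[h hm <-] hmin; exists h => // h' h'm.
by apply: hmin; apply/asboolP; exists h'.
Qed.

Variables (r h : grid n d -> nat).
Hypothesis h_incr : incr_natfun h.
Hypothesis h_min : forall h', incr_natfun h' -> l1dist r h <= l1dist r h'.
Variables (c : nat) (U : grid n d -> bool).
Hypothesis U_incr : forall i, incr_in i U.

(** Add one to [h] on the part of its level [c] inside [U]. The result is still monotone because [U]
    is increasing; the distance drops by one where [c < r x] and grows by one where [r x <= c], so
    minimality gives the inequality. [lower_balance] subtracts one outside [U] instead. *)
Lemma raise_balance :
  \sum_x [&& h x == c, U x & c < r x] <= \sum_x [&& h x == c, U x & r x <= c].
Proof.
pose h' x := h x + ((h x == c) && U x).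
have h'm : incr_natfun h'.
  move=> i x v w vw; rewrite /h'; have := h_incr i x vw; have := U_incr vw (x := x) (i := i).
  by move: (U (upd x i v)) (U (upd x i w)) => [] []; lia.
have : l1dist r h' + \sum_x [&& h x == c, U x & c < r x] =
       l1dist r h + \sum_x [&& h x == c, U x & r x <= c].
  rewrite -!big_split; apply: eq_bigr => x _ /=; rewrite /h'.
  by case: (U x); lia.
by have := h_min h'm; lia.
Qed.

Lemma lower_balance :
  \sum_x [&& h x == c, ~~ U x & r x < c] <= \sum_x [&& h x == c, ~~ U x & c <= r x].
Proof.
(* At level zero [h] cannot be lowered, but no value of [r] is below it either. *)
case: (posnP c) => [->|c0]; first by rewrite big1 // => x _; rewrite ltn0 !andbF.
pose h' x := h x - ((h x == c) && ~~ U x).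
have h'm : incr_natfun h'.
  move=> i x v w vw; rewrite /h'; have := h_incr i x vw; have := U_incr vw (x := x) (i := i).
  by move: (U (upd x i v)) (U (upd x i w)) => [] []; lia.
have : l1dist r h' + \sum_x [&& h x == c, ~~ U x & r x < c] =
       l1dist r h + \sum_x [&& h x == c, ~~ U x & c <= r x].
  rewrite -!big_split; apply: eq_bigr => x _ /=; rewrite /h'.
  by case: (U x); lia.
by have := h_min h'm; lia.
Qed.

End NearestMonotone.
End Grid.

(** * Dimension reduction *)

Section NatDimensionReduction.
Variables n d : nat.
Hypothesis n_gt0 : 0 < n.
Variables (r : grid n d -> nat) (Z : 'I_d -> {set grid n d}).
Hypothesis r_incr : forall i x (v w : 'I_n), v <= w ->
  upd x i v \notin Z i -> upd x i w \notin Z i -> r (upd x i v) <= r (upd x i w).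

(* The sets [h = c] split the real-valued problem into Boolean ones: on each
   of them [h] is locally constant, and the minimality of [h] says that a
   constant is a nearest monotone function to the thresholds of [r] at [c]. *)
Lemma threshold_completion (h : grid n d -> nat) c (P : pred nat) :
  incr_natfun h -> (forall a b, a <= b -> P a -> P b) ->
  exists2 g, forall i, incr_in i g &
    hdist (fun x => (c < h x) || ((h x == c) && P (r x))) g
      <= 2 * \sum_i #|Z i :&: [set x | h x == c]|.
Proof.
move=> hm Pm; pose b x := (c < h x) || ((h x == c) && P (r x)).
have bZ i : exists2 u, incr_in i u & hdist b u <= #|Z i :&: [set x | h x == c]|.
  apply: incr_in_completion => x v w vw; rewrite !inE !negb_and /b.
  have := hm i x _ _ vw; have := @r_incr i x v w vw.
  case: (upd x i v \in Z i) => [_|/(_ isT)] /=.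
    by case: ltngtP => //= hv; case: ltngtP => //=; lia.
  case: (upd x i w \in Z i) => [_|/(_ isT)] /=.
    by case: (ltngtP c (h (upd x i w))) => //= hw; case: ltngtP => //=; lia.
  move=> rvw hvw _ _; case: ltngtP => //= hv; case: ltngtP => //=; try lia.
  by move=> _; exact: Pm.
have /choice[u uP] : forall i, exists u, incr_in i u /\ hdist b u <= #|Z i :&: [set x | h x == c]|.
  by move=> i; have [u] := bZ i; exists u.
have [g gm gb] := boolean_dimension_reduction b n_gt0 (fun i => (uP i).1).
exists g => //; apply: leq_trans gb _.
by rewrite leq_mul2l leq_sum // => i _; case: (uP i).
Qed.

Lemma nat_dimension_reduction :
  exists2 h, incr_natfun h & hdist r h <= 4 * \sum_i #|Z i|.
Proof.
have [h hm hmin] := exists_l1_nearest r; exists h => //.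
have above c : \sum_x [&& h x == c & c < r x] <= 2 * \sum_i #|Z i :&: [set x | h x == c]|.
  have [|g gm] := @threshold_completion h c (fun a => c < a) hm.
    by move=> a b ab; lia.
  apply: leq_trans; have := raise_balance hm hmin c gm => bal.
  (* Points of the level above the threshold and outside [g] are disagreements with [g]. Those
     inside [g] are, by minimality of [h], at most as many as the points in [g] with [r x <= c],
     which are disagreements too. *)
  apply: leq_trans (_ : \sum_x [&& h x == c, g x & c < r x] +
                        \sum_x [&& h x == c, ~~ g x & c < r x] <= _).
    by rewrite -big_split leq_sum // => x _ /=; case: (g x); lia.
  apply: leq_trans (leq_add bal (leqnn _)) _.
  by rewrite -big_split leq_sum // => x _ /=; case: (g x); lia.
have below c : \sum_x [&& h x == c & r x < c] <= 2 * \sum_i #|Z i :&: [set x | h x == c]|.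
  have [|g gm] := @threshold_completion h c (fun a => c <= a) hm.
    by move=> a b ab; lia.
  apply: leq_trans; have := lower_balance hm hmin c gm => bal.
  apply: leq_trans (_ : \sum_x [&& h x == c, ~~ g x & r x < c] +
                        \sum_x [&& h x == c, g x & r x < c] <= _).
    by rewrite -big_split leq_sum // => x _ /=; case: (g x); lia.
  apply: leq_trans (leq_add bal (leqnn _)) _.
  by rewrite -big_split leq_sum // => x _ /=; case: (g x); lia.
(* The levels of [h] below [B] partition the grid, so the bounds for single levels add up; the
   factor 4 is 2 for [above] plus 2 for [below]. *)
pose B := (\max_x h x).+1.
have level (k : grid n d -> nat) : \sum_x k x = \sum_(c < B) \sum_(x | h x == c) k x.
  rewrite (exchange_big_dep xpredT) //=; apply: eq_bigr => x _.
  have hx : h x < B by rewrite ltnS leq_bigmax.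
  by rewrite (big_pred1 (Ordinal hx)) // => c; rewrite eq_sym -val_eqE.
have -> : \sum_i #|Z i| = \sum_(c < B) \sum_i #|Z i :&: [set x | h x == c]|.
  rewrite exchange_big; apply: eq_bigr => i _.
  rewrite -sum1_card big_mkcond level; apply: eq_bigr => c _.
  by rewrite -big_mkcondr -sum1_card; apply: eq_bigl => x; rewrite !inE andbC.
rewrite /hdist level big_distrr leq_sum // => c _ /=.
apply: leq_trans (_ : \sum_x [&& h x == c & c < r x] + \sum_x [&& h x == c & r x < c] <= _);
  last by apply: leq_trans (leq_add (above c) (below c)) _; rewrite -mulnDl.
rewrite big_mkcond -big_split leq_sum // => x _ /=; case: eqP => // -> /=.
by case: ltngtP.
Qed.

End NatDimensionReduction.

(** * Real-valued functions and prescribed directions *)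

Section RealDimensionReduction.
Local Open Scope ring_scope.
Variables (R : realType) (n d : nat).
Implicit Types (f : grid n d -> R) (i : 'I_d) (Z : {set grid n d}).

Definition nondecr_off Z i f := forall x (v w : 'I_n), (v <= w)%N ->
  upd x i v \notin Z -> upd x i w \notin Z -> f (upd x i v) <= f (upd x i w).

Definition nonincr_off Z i f := forall x (v w : 'I_n), (v <= w)%N ->
  upd x i v \notin Z -> upd x i w \notin Z -> f (upd x i w) <= f (upd x i v).

Lemma nondecr_off0 i f : nondecr_off set0 i f <-> nondecreasing_in i f.
Proof.
split=> [fi x y xy xyi|fi x v w vw _ _].
  have -> : x = upd y i (x i).
    by apply/ffunP => j; rewrite ffunE; case: eqP => [->|/eqP/xy].
  by rewrite -{2}(upd_id y i); apply: fi => //; rewrite inE.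
by apply: fi; rewrite ?updE // => j ji; rewrite !upd_neq.
Qed.

Lemma nonincr_off0 i f : nonincr_off set0 i f <-> nonincreasing_in i f.
Proof.
split=> [fi x y xy xyi|fi x v w vw _ _].
  have -> : x = upd y i (x i).
    by apply/ffunP => j; rewrite ffunE; case: eqP => [->|/eqP/xy].
  by rewrite -{1}(upd_id y i); apply: fi => //; rewrite inE.
by apply: fi; rewrite ?updE // => j ji; rewrite !upd_neq.
Qed.

(** Replaces the real values by natural numbers with the same order and the same ties. *)
Definition rank f x := #|[set y | f y < f x]|.

Lemma le_rank f x y : (rank f x <= rank f y)%N = (f x <= f y).
Proof.
apply/idP/idP => [|fxy]; last first.
  by apply/subset_leq_card/subsetP => z; rewrite !inE => /lt_le_trans; apply.
rewrite leqNgt; apply: contraR; rewrite -ltNge => fyx.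
apply/proper_card/properP; split.
  by apply/subsetP => z; rewrite !inE => /lt_trans; apply.
by exists y; rewrite !inE ?ltxx.
Qed.

Lemma monotone_dimension_reduction f (Z : 'I_d -> {set grid n d}) : (0 < n)%N ->
  (forall i, nondecr_off (Z i) i f) ->
  exists2 g : grid n d -> R, forall i, nondecr_off set0 i g &
    (hdist f g <= 4 * \sum_i #|Z i|)%N.
Proof.
move=> n0 fZ; have [|h hm hd] := nat_dimension_reduction (r := rank f) (Z := Z) n0.
  by move=> i x v w vw vZ wZ; rewrite le_rank; exact: fZ.
(* A lower bound of all values of [f], so that as the starting value it does not disturb the maxima
   below. These maxima translate [h] from ranks back to values of [f], and return [f x] wherever
   [h x] is the rank of [x]. *)
pose m := - \sum_y `|f y|.
have mf x : m <= f x.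
  rewrite lerNl; apply: le_trans (_ : `|f x| <= _); first by rewrite -normrN ler_norm.
  by rewrite (bigD1 x) //= lerDl sumr_ge0.
exists (fun x => \big[Order.max/m]_(y | (rank f y <= h x)%N) f y).
  by move=> i x v w vw _ _; apply: sub_bigmax => y /leq_trans; apply; exact: hm.
apply: leq_trans hd; rewrite leq_sum // => x _; case: (eqVneq (rank f x) (h x)) => [e|_].
  rewrite -e; suff <- : f x = \big[Order.max/m]_(y | (rank f y <= rank f x)%N) f y.
    by rewrite eqxx.
  apply/le_anti/andP; split; first by apply: le_bigmax_cond; rewrite leqnn.
  by apply/bigmax_leP; split => // y; rewrite le_rank.
exact: leq_b1.
Qed.

Definition flip (s : 'I_d -> bool) (x : grid n d) : grid n d :=
  [ffun j => if s j then x j else rev_ord (x j)].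

Lemma flipK s : involutive (flip s).
Proof.
by move=> x; apply/ffunP => j; rewrite !ffunE; case: (s j); rewrite ?rev_ordK.
Qed.

Lemma flip_upd s x i v :
  flip s (upd x i v) = upd (flip s x) i (if s i then v else rev_ord v).
Proof.
by apply/ffunP => j; rewrite !ffunE; case: eqP => [->|_]; case: (s _).
Qed.

(** Reversing the coordinates with [s i = false] reduces to the monotone case; [flip s] is a
    bijection, so distances and cardinalities are kept. *)
Lemma unate_dimension_reduction f (s : 'I_d -> bool) (Z : 'I_d -> {set grid n d}) :
  (0 < n)%N ->
  (forall i, if s i then nondecr_off (Z i) i f else nonincr_off (Z i) i f) ->
  exists2 g : grid n d -> R, unate g & (hdist f g <= 4 * \sum_i #|Z i|)%N.
Proof.
move=> n0 fZ.
have flipI := inv_inj (flipK s).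
have [i x v w vw|g gm gd] := @monotone_dimension_reduction (f \o flip s)
    (fun i => [set x | flip s x \in Z i]) n0.
  rewrite !inE /= !flip_upd; have := fZ i; case: (s i) => fi vZ wZ; apply: fi => //=.
  by rewrite leq_sub2l.
exists (g \o flip s).
  move=> i; case si: (s i); [right; apply/nondecr_off0|left; apply/nonincr_off0];
    move=> x v w vw _ _ /=; rewrite !flip_upd si; apply: gm; rewrite ?inE //=.
  by rewrite leq_sub2l.
rewrite (eq_bigr (fun i => #|Z i|)) in gd; last first.
  move=> i _; rewrite -(card_imset (Z i) flipI); apply: eq_card => x.
  by rewrite inE -{2}(flipK s x) (mem_imset _ _ flipI).
apply: leq_trans gd; rewrite /hdist (reindex_inj flipI) leq_sum // => x _ /=.
by rewrite flipK.
Qed.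

End RealDimensionReduction.

Local Open Scope ring_scope.

(** * Rises and falls along a line *)

Section DyadicPath.
Local Open Scope nat_scope.
Variable n : nat.
Implicit Types (v w : 'I_n).

(** The number of scales: [n < 2 ^ depth], so at scale [depth] all indices lie in one block. *)
Definition depth := (trunc_log 2 n).+1.

Definition mid v : 'I_n := insubd v n./2.

(* [insubd v m] is [v] when [m] falls outside ['I_n]. *)
Definition dyadic v : seq 'I_n :=
  [:: v, mid v & flatten [seq [:: insubd v (v %/ 2 ^ k * 2 ^ k);
                                  insubd v ((v %/ 2 ^ k).+1 * 2 ^ k)] | k <- iota 0 depth]].

Lemma size_dyadic v : size (dyadic v) = (2 * depth).+2.
Proof.
rewrite /= size_flatten sumnE !big_map (eq_bigr (fun=> 2)) // big_const_seq count_predT size_iota.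
by rewrite iter_addn /depth; lia.
Qed.

Lemma val_mid v : mid v = n./2 :> nat.
Proof. by rewrite val_insubd ifT // -divn2 ltn_Pdiv // (leq_trans _ (ltn_ord v)). Qed.

Lemma mem_dyadic v : v \in dyadic v.
Proof. by rewrite inE eqxx. Qed.

Lemma mem_mid v w : mid w \in dyadic v.
Proof.
suff -> : mid w = mid v by rewrite !inE eqxx orbT.
by apply/val_inj; rewrite /= !val_mid.
Qed.

(* The common point is the multiple of the largest power of two lying in
   the interval from [v] (excluded) to [w]. *)
Lemma dyadic_meet v w : v <= w ->
  exists z, [/\ z \in dyadic v, z \in dyadic w, v <= z & z <= w].
Proof.
rewrite leq_eqVlt => /predU1P[/val_inj->|vw].
  by exists w; rewrite !mem_dyadic.
have ex : exists k, v %/ 2 ^ k == w %/ 2 ^ k.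
  exists n; have h u : u < n -> u %/ 2 ^ n = 0.
    by move=> un; rewrite divn_small // (ltn_trans un) // ltn_expl.
  by rewrite !h.
(* [k.+1] is the first scale at which [v] and [w] share a block, so at scale [k] they lie in
   adjacent blocks; scale 0 is excluded by [v < w]. *)
case: (ex_minnP ex) => -[|k] /eqP kE kmin; first by move: kE; rewrite !divn1; lia.
have kD : k < depth.
  have h u : u < n -> u %/ 2 ^ depth = 0.
    move=> un; rewrite divn_small // (ltn_trans un) //.
    by rewrite trunc_log_ltn.
  by have := kmin depth; rewrite !h // eqxx => /(_ isT).
have kv : v %/ 2 ^ k != w %/ 2 ^ k by apply/negP => /kmin; rewrite ltnn.
have le_k : v %/ 2 ^ k <= w %/ 2 ^ k by rewrite leq_div2r // ltnW.
have kS : w %/ 2 ^ k = (v %/ 2 ^ k).+1.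
  by move: kE kv le_k; rewrite expnSr !divnMA; lia.
have wk : w %/ 2 ^ k * 2 ^ k <= w by rewrite leq_trunc_div.
have zn : w %/ 2 ^ k * 2 ^ k < n by rewrite (leq_ltn_trans wk).
exists (Ordinal zn); split => //=.
- rewrite 2!inE; apply/orP; right; apply/orP; right; apply/flatten_mapP.
  exists k; first by rewrite mem_iota.
  by rewrite !inE -kS; apply/orP; right; rewrite -val_eqE /= val_insubd zn.
- rewrite 2!inE; apply/orP; right; apply/orP; right; apply/flatten_mapP.
  exists k; first by rewrite mem_iota.
  by rewrite !inE; apply/orP; left; rewrite -val_eqE /= val_insubd zn.
- by rewrite kS ltnW // ltn_ceil // expn_gt0.
Qed.

End DyadicPath.

(** * Bad points of a single line *)

Section Line.
Variables (R : realType) (n : nat).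
Implicit Types (phi : 'I_n -> R) (s : seq 'I_n) (v w a b : 'I_n).

Definition line_rises phi s :=
  has (fun a => has (fun b => (a < b)%N && (phi a < phi b)) s) s.

Definition line_falls phi s := line_rises (fun v => - phi v) s.

Lemma line_risesP phi s a b : a \in s -> b \in s -> (a < b)%N -> phi a < phi b ->
  line_rises phi s.
Proof.
by move=> sa sb ab fab; apply/hasP; exists a => //; apply/hasP; exists b; rewrite ?ab.
Qed.

Lemma line_fallsP phi s a b : a \in s -> b \in s -> (a < b)%N -> phi b < phi a ->
  line_falls phi s.
Proof. by move=> sa sb ab fab; apply: line_risesP sa sb ab _; rewrite ltrN2. Qed.

Lemma line_rises_sub phi s t : {subset s <= t} -> line_rises phi s -> line_rises phi t.
Proof.
move=> st /hasP[a sa /hasP[b sb /andP[ab fab]]].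
exact: line_risesP (st _ sa) (st _ sb) ab fab.
Qed.

Definition path_mixed phi v w :=
  line_rises phi (w :: dyadic v) && line_falls phi (w :: dyadic v).

Lemma card_geq_mid v : (2 * #|[set w : 'I_n | (mid v <= w)%N]| >= n)%N.
Proof.
rewrite -sum1_card big_mkcond /= (eq_bigr (fun w : 'I_n => (n./2 <= w : nat)%N)); last first.
  by move=> w _; rewrite inE val_mid; case: (_ <= _)%N.
by rewrite sum_geq; lia.
Qed.

Lemma card_leq_mid v : (2 * #|[set w : 'I_n | (w <= mid v)%N]| >= n)%N.
Proof.
have := ltn_ord v => vn.
suff : (#|[set w : 'I_n | (w <= mid v)%N]| + (n - n./2.+1) = n)%N by lia.
rewrite -sum_geq; last by lia.
rewrite -sum1_card big_mkcond -big_split /= (eq_bigr (fun=> 1%N)).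
  by rewrite sum_nat_const card_ord muln1.
by move=> w _; rewrite inE val_mid; case: ltnP.
Qed.

(* A point whose path rises while it seldom sees rises against random points
   of its line has the value of the middle point: otherwise half of the line
   would produce either a rising pair with it or a fall along its path. *)
Lemma rises_eq_mid phi v :
  (4 * #|[set w | path_mixed phi v w]| < n)%N ->
  (4 * #|[set w | line_rises phi [:: v; w]]| < n)%N ->
  line_rises phi (dyadic v) ->
  ~~ line_falls phi (dyadic v) /\ phi v = phi (mid v).
Proof.
set W1 := [set w | _]; set W2 := [set w | _] => W1n W2n rv.
have subc w : {subset dyadic v <= w :: dyadic v} by move=> a av; rewrite inE av orbT.
have rvw w : line_rises phi (w :: dyadic v) by exact: line_rises_sub rv.
have nofall : ~~ line_falls phi (dyadic v).
  apply/negP => fv; suff : #|W1| = n by move: W1n; lia.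
  rewrite -[RHS]card_ord -cardsT; congr #|pred_of_set _|; apply/setP => w; rewrite !inE.
  by rewrite /path_mixed rvw; apply: line_rises_sub fv.
(* Each of the two sets holds less than a quarter of the line. *)
have half (A : {set 'I_n}) : A \subset W1 :|: W2 -> (2 * #|A| < n)%N.
  move=> /subset_leq_card sA; have [cU _] := leq_card_setU W1 W2.
  by have := leq_trans sA cU; clearbody W1 W2; lia.
split => //; set m := mid v in half *.
have mD : m \in dyadic v := mem_mid v v.
have vD := mem_dyadic v.
have mDw w := subc w _ mD.
have W1P w : (m < w)%N && (phi w < phi m) || (w < m)%N && (phi m < phi w) -> w \in W1.
  rewrite inE /path_mixed rvw => /orP[] /andP[mw fmw].
    by apply: line_fallsP (mDw w) (mem_head _ _) mw fmw.
  by apply: line_fallsP (mem_head _ _) (mDw w) mw fmw.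
have W2P w : (v < w)%N && (phi v < phi w) || (w < v)%N && (phi w < phi v) -> w \in W2.
  have v2 : v \in [:: v; w] by rewrite inE eqxx.
  have w2 : w \in [:: v; w] by rewrite !inE eqxx orbT.
  rewrite inE => /orP[] /andP[vw fvw]; first exact: line_risesP v2 w2 vw fvw.
  exact: line_risesP w2 v2 vw fvw.
apply/eqP; case: (ltngtP v m) => [vm|mv|/val_inj->//]; case: ltgtP => // fvm.
(* A point [w] beyond [m] either has a value below [phi m], which adds a fall to the rising path, or
   it forms a rising pair with [v]. *)
- have : [set w : 'I_n | (m <= w)%N] \subset W1 :|: W2.
    apply/subsetP => w; rewrite inE leq_eqVlt => /predU1P[/val_inj<-|mw].
      by rewrite inE (W2P m) ?orbT // vm fvm.
    rewrite inE; case: (ltP (phi w) (phi m)) => fmw; first by rewrite W1P // mw fmw.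
    by rewrite (W2P w) ?orbT // (ltn_trans vm mw) (lt_le_trans fvm fmw).
  by move=> /half; rewrite ltnNge => /negP[]; exact: card_geq_mid.
- by case/negP: nofall; apply: line_fallsP vD mD vm fvm.
- by case/negP: nofall; apply: line_fallsP mD vD mv fvm.
- have : [set w : 'I_n | (w <= m)%N] \subset W1 :|: W2.
    apply/subsetP => w; rewrite inE leq_eqVlt => /predU1P[/val_inj->|wm].
      by rewrite inE (W2P m) ?orbT // mv fvm orbT.
    rewrite inE; case: (ltP (phi m) (phi w)) => fmw; first by rewrite W1P // wm fmw orbT.
    by rewrite (W2P w) ?orbT // (ltn_trans wm mv) (le_lt_trans fmw fvm) orbT.
  by move=> /half; rewrite ltnNge => /negP[]; exact: card_leq_mid.
Qed.

Definition path_bad phi v := (n <= 4 * #|[set w | path_mixed phi v w]|)%N.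
Definition pair_bad phi v := (n <= 4 * #|[set w | line_rises phi [:: v; w]]|)%N.

(** If [phi v < phi w], a rise occurs on the path of [v] or of [w], through their common point [z].
    If both paths rise, both values equal the one at the middle [m], a contradiction. If only one
    rises, its endpoint has the value of [m]; the absence of a rise on the other path then forces
    [w < m] or [m < v], and [z] and [m] form a fall on the rising path, which [rises_eq_mid]
    excludes. *)
Lemma nonincr_off_bad phi v w : (v <= w)%N ->
  ~~ (path_bad phi v || pair_bad phi v) -> ~~ (path_bad phi w || pair_bad phi w) ->
  phi w <= phi v.
Proof.
rewrite !negb_or -!ltnNge => vw /andP[v1 v2] /andP[w1 w2].
rewrite leNgt; apply/negP => fvw.
have [z [zv zw vz wz]] := dyadic_meet vw.
have vv := mem_dyadic v; have ww := mem_dyadic w.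
have mv := mem_mid v v; have mw := mem_mid w v.
have mwv : mid w = mid v by apply/val_inj; rewrite /= !val_mid.
have Rv := rises_eq_mid v1 v2; have Rw := rises_eq_mid w1 w2; rewrite mwv in Rw.
set m := mid v in mv mw Rv Rw.
case: (boolP (line_rises phi (dyadic v))) => rv.
  have [nofall fv] := Rv rv.
  case: (boolP (line_rises phi (dyadic w))) => rw.
    by have [_ fw] := Rw rw; rewrite fv fw ltxx in fvw.
  have wm : (w < m)%N.
    rewrite ltnNge leq_eqVlt; apply/negP => /predU1P[/val_inj e|mw'].
      by rewrite -e -fv ltxx in fvw.
    by case/negP: rw; apply: line_risesP mw ww mw' _; rewrite -fv.
  have fz : phi w <= phi z.
    move: wz; rewrite leq_eqVlt => /predU1P[/val_inj->//|zw'].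
    by rewrite leNgt; apply: contra rw; exact: line_risesP.
  case/negP: nofall; apply: line_fallsP zv mv (leq_ltn_trans wz wm) _.
  by rewrite -fv; exact: lt_le_trans fz.
have fz : phi z <= phi v.
  move: vz; rewrite leq_eqVlt => /predU1P[/val_inj->//|vz'].
  by rewrite leNgt; apply: contra rv; exact: line_risesP.
have rw : line_rises phi (dyadic w).
  have fzw := le_lt_trans fz fvw.
  apply: (line_risesP zw ww _ fzw); rewrite ltn_neqAle wz andbT.
  by apply/eqP => /val_inj e; rewrite e ltxx in fzw.
have [nofall fw] := Rw rw.
have mlv : (m < v)%N.
  rewrite ltnNge leq_eqVlt; apply/negP => /predU1P[/val_inj e|vm].
    by rewrite fw e ltxx in fvw.
  by case/negP: rv; apply: line_risesP vv mv vm _; rewrite -fw.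
case/negP: nofall; apply: line_fallsP mw zw (leq_trans mlv vz) _.
by rewrite -fw; exact: le_lt_trans fvw.
Qed.

End Line.

(** * Random samples on the lines of the grid *)

Section Sampling.
Variables (R : realType) (n d : nat).
Implicit Types (f : grid n d -> R) (i : 'I_d) (qs : seq (grid n d)) (o : grid n d * 'I_n).

Definition rises i f qs := has (fun p : grid n d =>
  has (fun q : grid n d => [&& p == upd q i (p i), (p i < q i)%N & f p < f q]) qs) qs.

Definition falls i f qs := rises i (fun x => - f x) qs.

Definition mixed i f qs := rises i f qs && falls i f qs.

Lemma rises_sub i f qs qs' : {subset qs <= qs'} -> rises i f qs -> rises i f qs'.
Proof.
move=> sub /hasP[p sp /hasP[q sq pq]].
by apply/hasP; exists p; [exact: sub|apply/hasP; exists q => //; exact: sub].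
Qed.

Lemma eq_rises i f g qs : {in qs, f =1 g} -> rises i f qs = rises i g qs.
Proof.
by move=> fg; apply: eq_in_has => p pq; apply: eq_in_has => q qq; rewrite !fg.
Qed.

Lemma eq_falls i f g qs : {in qs, f =1 g} -> falls i f qs = falls i g qs.
Proof. by move=> fg; apply: eq_rises => x /fg->. Qed.

Lemma unate_not_mixed i f qs : unate f -> ~~ mixed i f qs.
Proof.
have differ (p q : grid n d) : p == upd q i (p i) -> differ_only_at i p q.
  by move=> /eqP e j ji; rewrite e upd_neq.
move=> /(_ i)[] fi; rewrite negb_and; apply/orP; [left|right];
  apply/hasPn => p _; apply/hasPn => q _; apply/and3P => -[/differ pq lt].
  by rewrite ltNge fi // ltnW.
by rewrite ltrN2 ltNge fi // ltnW.
Qed.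

Lemma rises_map i f x s :
  rises i f (map (upd x i) s) = line_rises (fun v => f (upd x i v)) s.
Proof.
rewrite /rises /line_rises has_map; apply: eq_has => a /=.
by rewrite has_map; apply: eq_has => b /=; rewrite upd_upd !updE eqxx.
Qed.

(** A sample is a point with a coordinate value, independent of the direction; the value selects the
    random second point on the [i]-line. *)
Definition full_queries i o := map (upd o.1 i) (o.2 :: dyadic (o.1 i)).

Definition pair_queries i o := [:: o.1; upd o.1 i o.2].

Lemma size_full_queries i o : size (full_queries i o) = (2 * depth n + 3)%N.
Proof. by rewrite size_map -[LHS]/(size (dyadic (o.1 i))).+1 size_dyadic; lia. Qed.

Definition bad i f := [set x | path_bad (fun v => f (upd x i v)) (x i)
                            || pair_bad (fun v => f (upd x i v)) (x i)].

Lemma nonincr_off_bad_set i f : nonincr_off (bad i f) i f.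
Proof.
move=> x v w vw; rewrite !inE !updE.
rewrite (_ : (fun u => f (upd (upd x i v) i u)) = (fun u => f (upd x i u))); last first.
  by apply/funext => u; rewrite upd_upd.
rewrite (_ : (fun u => f (upd (upd x i w) i u)) = (fun u => f (upd x i u))); last first.
  by apply/funext => u; rewrite upd_upd.
exact: (nonincr_off_bad (phi := fun u => f (upd x i u))).
Qed.

Definition count_samples (P : pred (grid n d * 'I_n)) := (\sum_o P o)%N.

Lemma card_bad i f : (n * #|bad i f| <=
  4 * (count_samples (fun o => mixed i f (full_queries i o)) +
       count_samples (fun o => rises i f (pair_queries i o))))%N.
Proof.
rewrite /count_samples -(pair_bigA _ (fun x w => mixed i f (full_queries i (x, w)) : nat)) /=.
rewrite -(pair_bigA _ (fun x w => rises i f (pair_queries i (x, w)) : nat)) /=.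
rewrite -big_split /= big_distrr /= -sum1_card big_mkcond big_distrr leq_sum //= => x _.
have -> : (\sum_w mixed i f (full_queries i (x, w)))%N =
    #|[set w | path_mixed (fun v => f (upd x i v)) (x i) w]|.
  rewrite -sum1dep_card [RHS]big_mkcond; apply: eq_bigr => w _.
  by rewrite /mixed /falls !rises_map /= -/(path_mixed _ _ _); case: path_mixed.
have -> : (\sum_w rises i f (pair_queries i (x, w)))%N =
    #|[set w | line_rises (fun v => f (upd x i v)) [:: x i; w]]|.
  rewrite -sum1dep_card [RHS]big_mkcond; apply: eq_bigr => w _.
  have -> : pair_queries i (x, w) = map (upd x i) [:: x i; w] by rewrite /= upd_id.
  by rewrite rises_map; case: line_rises.
rewrite inE; case: ifP => [/orP[] h|_]; rewrite ?muln0 // muln1 (leq_trans h) // leq_mul2l.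
  by rewrite leq_addr orbT.
by rewrite leq_addl orbT.
Qed.

(** In each direction the rarer of rises and falls is removed, using the bad set of [f] or of [-f].
    The factor 16 is 4 from [unate_dimension_reduction] times 4 from [card_bad]. *)
Lemma unate_correction f : (0 < n)%N -> exists2 g : grid n d -> R, unate g &
  (n * hdist f g <= 16 * \sum_i (count_samples (fun o => mixed i f (full_queries i o)) +
     minn (count_samples (fun o => rises i f (pair_queries i o)))
          (count_samples (fun o => falls i f (pair_queries i o)))))%N.
Proof.
move=> n0; pose f' x := - f x.
pose s i := (count_samples (fun o => falls i f (pair_queries i o)) <=
             count_samples (fun o => rises i f (pair_queries i o)))%N.
have [i|g gu gd] := @unate_dimension_reduction R n d f s
    (fun i => if s i then bad i f' else bad i f) n0.
  case: (s i); last exact: nonincr_off_bad_set.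
  by move=> x v w vw xv xw; rewrite -lerN2; exact: (nonincr_off_bad_set (f := f')).
exists g => //; apply: leq_trans (leq_mul (leqnn n) gd) _.
rewrite mulnCA -[16%N]/(4 * 4)%N -mulnA leq_mul2l /= !big_distrr leq_sum //= => i _.
have mixedN o : mixed i f' (full_queries i o) = mixed i f (full_queries i o).
  rewrite /mixed andbC; congr (_ && _); apply: eq_rises => x _.
  by rewrite /f' opprK.
case: (boolP (s i)) => si.
  rewrite (minn_idPr si); apply: leq_trans (card_bad i f') _.
  by rewrite (_ : count_samples _ = count_samples (fun o => mixed i f (full_queries i o))) //;
     apply: eq_bigr => o _; rewrite mixedN.
rewrite (minn_idPl _); first exact: card_bad.
by rewrite ltnW // ltnNge.
Qed.

End Sampling.

(** * Finite probability and decision trees *)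

Section Mean.
Variable R : realType.
Implicit Types A B : finType.

Definition mean A (F : A -> R) : R := (\sum_a F a) / #|A|%:R.

Lemma mean_le A (F G : A -> R) : (forall a, F a <= G a) -> mean F <= mean G.
Proof. by move=> FG; rewrite ler_wpM2r ?invr_ge0 // ler_sum. Qed.

Lemma meanD A (F G : A -> R) : mean (fun a => F a + G a) = mean F + mean G.
Proof. by rewrite /mean big_split mulrDl. Qed.

Lemma meanZ A c (F : A -> R) : mean (fun a => c * F a) = c * mean F.
Proof. by rewrite /mean -mulr_sumr mulrA. Qed.

Lemma mean_const A c : (0 < #|A|)%N -> mean (fun _ : A => c) = c.
Proof.
by move=> A0; rewrite /mean sumr_const -[c *+ _]mulr_natr mulfK // pnatr_eq0 -lt0n.
Qed.

Lemma mean_ge0 A (F : A -> R) : (forall a, 0 <= F a) -> 0 <= mean F.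
Proof. by move=> F0; rewrite mulr_ge0 ?invr_ge0 // sumr_ge0. Qed.

Lemma eq_mean A (F G : A -> R) : F =1 G -> mean F = mean G.
Proof. by move=> /funext->. Qed.

Lemma meanN A (P : pred A) : (0 < #|A|)%N ->
  mean (fun a => (~~ P a)%:R) = 1 - mean (fun a => (P a)%:R).
Proof.
move=> A0; apply/eqP; rewrite eq_sym subr_eq -meanD -[X in X == _](mean_const 1 A0).
by apply/eqP/eq_mean => a; case: (P a); rewrite ?add0r ?addr0.
Qed.

Lemma mean_le1 A (P : pred A) : mean (fun a => (P a)%:R) <= 1.
Proof.
rewrite /mean; case: (posnP #|A|) => [->|A0]; first by rewrite invr0 mulr0.
rewrite ler_pdivrMr ?ltr0n // mul1r -natr_sum ler_nat -sum1_card leq_sum // => a _.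
exact: leq_b1.
Qed.

Lemma mean_pair A B (F : A * B -> R) : mean F = mean (fun a => mean (fun b => F (a, b))).
Proof.
have e : \sum_p F p = \sum_a \sum_b F (a, b) by rewrite pair_bigA; apply: eq_bigr => -[].
by rewrite /mean card_prod natrM e -mulr_suml invfM (mulrC #|A|%:R^-1) mulrA.
Qed.

(** The expectation over [M] independent uniform elements, in recursive form for inductions that
    condition on the first one. *)
Fixpoint list_mean A M (F : seq A -> R) : R :=
  if M is M'.+1 then mean (fun a => list_mean M' (fun l => F (a :: l))) else F [::].

Lemma mean_tuple A M (F : seq A -> R) : mean (fun t : M.-tuple A => F t) = list_mean M F.
Proof.
elim: M F => [|M IH] F /=.
  rewrite /mean card_tuple expn0 divr1 (big_pred1 [tuple]) // => t.
  by apply/esym/eqP/val_inj; case: t => -[].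
under [RHS]eq_mean do rewrite -IH.
rewrite /mean !card_tuple expnS natrM invfM mulrA mulrAC -mulr_suml; congr (_ / _).
congr (_ / _); rewrite pair_bigA /=.
rewrite (reindex (fun p : A * M.-tuple A => [tuple of p.1 :: p.2])) //=.
exists (fun t => (thead t, [tuple of behead t])) => [[a t] _|t _] /=.
  by congr (_, _); apply/val_inj.
by rewrite [RHS]tuple_eta.
Qed.

Lemma eq_list_mean A M (F G : seq A -> R) : F =1 G -> list_mean M F = list_mean M G.
Proof. by move=> /funext->. Qed.

Lemma list_mean_le A M (F G : seq A -> R) :
  (forall l, F l <= G l) -> list_mean M F <= list_mean M G.
Proof. by elim: M F G => //= M IH F G FG; apply: mean_le => a; apply: IH. Qed.

Lemma list_meanD A M (F G : seq A -> R) :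
  list_mean M (fun l => F l + G l) = list_mean M F + list_mean M G.
Proof.
elim: M F G => //= M IH F G; rewrite -meanD; apply: eq_mean => a.
exact: (IH (fun l => F (a :: l))).
Qed.

Lemma list_meanZ A M c (F : seq A -> R) : list_mean M (fun l => c * F l) = c * list_mean M F.
Proof.
elim: M F => //= M IH F; rewrite -meanZ; apply: eq_mean => a.
exact: (IH (fun l => F (a :: l))).
Qed.

Lemma list_mean_const A M c : (0 < #|A|)%N -> list_mean M (fun _ : seq A => c) = c.
Proof. by move=> A0; elim: M => //= M IH; rewrite IH mean_const. Qed.

Lemma list_mean_take_none A (P : pred A) K M : (0 < #|A|)%N -> (K <= M)%N ->
  list_mean M (fun l => (~~ has P (take K l))%:R) = (1 - mean (fun a => (P a)%:R)) ^+ K.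
Proof.
move=> A0; elim: K M => [|K IH] M KM.
  by rewrite expr0 -[RHS](list_mean_const M 1 A0); apply: eq_list_mean => l; rewrite take0.
case: M KM => // M KM; rewrite exprS -(IH M KM) -meanN //= mulrC -meanZ.
apply: eq_mean => a; rewrite mulrC -list_meanZ; apply: eq_list_mean => l.
by rewrite negb_or; case: (P a); rewrite ?mul0r ?mul1r.
Qed.

(** This replaces exponential estimates: [K] trials all fail with probability at most 1 / (1 + K
    p). *)
Lemma bernoulli_inv (p : R) K : 0 <= p <= 1 -> (1 - p) ^+ K * (1 + K%:R * p) <= 1.
Proof.
move=> /andP[p0 p1]; elim: K => [|K IH]; first by rewrite mul1r mul0r addr0.
have e : (1 - p) ^+ K.+1 * (1 + K.+1%:R * p) =
  (1 - p) ^+ K * (1 + K%:R * p) - (1 - p) ^+ K * (K.+1%:R * p ^+ 2).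
  by rewrite exprSr -natr1; ring.
apply: le_trans IH; rewrite e gerBl mulr_ge0 ?exprn_ge0 ?subr_ge0 //.
by rewrite mulr_ge0 // sqr_ge0.
Qed.

End Mean.

(** * Composing and truncating decision trees *)

Section DecisionTrees.
Variables (X : eqType) (A : Type) (a0 : A).
Implicit Types (t : dtree X A) (f : X -> A) (qs : seq X).

Fixpoint bind t (k : bool -> dtree X A) : dtree X A :=
  match t with
  | Leaf b => k b
  | Query x h => Query x (fun a => bind (h a) k)
  end.

Lemma accepts_bind t k f : accepts (bind t k) f = accepts (k (accepts t f)) f.
Proof. by elim: t => //= x h IH. Qed.

Lemma queries_bind t k f : queries (bind t k) f = queries t f ++ queries (k (accepts t f)) f.
Proof. by elim: t => //= x h IH; rewrite IH. Qed.

(** The second tree runs even after a rejection by the first, so query lists are concatenated and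
    nonadaptivity survives. *)
Definition both t t' := bind t (fun b => bind t' (fun b' => Leaf X A (b && b'))).

Lemma accepts_both t t' f : accepts (both t t') f = accepts t f && accepts t' f.
Proof. by rewrite accepts_bind accepts_bind. Qed.

Lemma queries_both t t' f : queries (both t t') f = queries t f ++ queries t' f.
Proof. by rewrite queries_bind queries_bind /= cats0. Qed.

Fixpoint ask qs (k : seq A -> dtree X A) : dtree X A :=
  if qs is x :: qs' then Query x (fun a => ask qs' (fun l => k (a :: l))) else k [::].

Lemma accepts_ask qs k f : accepts (ask qs k) f = accepts (k (map f qs)) f.
Proof. by elim: qs k => //= x qs IH k; rewrite IH. Qed.

Lemma queries_ask qs k f : queries (ask qs k) f = qs ++ queries (k (map f qs)) f.
Proof. by elim: qs k => //= x qs IH k; rewrite IH. Qed.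

(** Turns a list of answers into a function, so that predicates on functions that read only the
    points of [qs] can be evaluated on answers. *)
Definition lookup qs (l : seq A) x := nth a0 l (index x qs).

Lemma lookup_map qs f : {in qs, lookup qs (map f qs) =1 f}.
Proof. by move=> x xq; rewrite /lookup (nth_map x) ?index_mem // nth_index. Qed.

(* A truncated run accepts, which preserves one-sidedness. *)
Fixpoint cut q t : dtree X A :=
  match t, q with
  | Leaf b, _ => Leaf X A b
  | Query x h, 0 => Leaf X A true
  | Query x h, q'.+1 => Query x (fun a => cut q' (h a))
  end.

Lemma size_queries_cut q t f : (size (queries (cut q t) f) <= q)%N.
Proof. by elim: t q => [b|x h IH] [|q] //=; exact: IH. Qed.

Lemma accepts_cut q t f : accepts t f -> accepts (cut q t) f.
Proof. by elim: t q => [b|x h IH] [|q] //=; exact: IH. Qed.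

Lemma accepts_cut_small q t f :
  (size (queries t f) <= q)%N -> accepts (cut q t) f = accepts t f.
Proof. by elim: t q => [b|x h IH] [|q] //=; exact: IH. Qed.

Variable S : Type.

Fixpoint run (rs : seq (S -> dtree X A)) (l : seq S) : dtree X A :=
  match rs, l with
  | r :: rs', s :: l' => both (r s) (run rs' l')
  | _, _ => Leaf X A true
  end.

End DecisionTrees.

(** * Independent rounds: acceptance probability and expected cost *)

Section RoundProbabilities.
Variables (R : realType) (X : eqType) (A : Type) (S : finType).
Hypothesis S_gt0 : (0 < #|S|)%N.
Implicit Types (r : S -> dtree X A) (rs : seq (S -> dtree X A)) (f : X -> A).

Definition reject_pr f r : R := mean (fun s => (~~ accepts (r s) f)%:R).

Definition mean_cost f r : R := mean (fun s => (size (queries (r s) f))%:R).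

Lemma reject_pr_ge0 f r : 0 <= reject_pr f r.
Proof. exact: mean_ge0. Qed.

(** The rounds are independent, so acceptance has probability the product of the 1 - p. One more
    round is absorbed by (1 - p)(1 + p + s) = 1 + s - p(p + s). *)
Lemma run_accept_pr f rs :
  list_mean (size rs) (fun l => (accepts (run rs l) f)%:R) *
    (1 + \sum_(r <- rs) reject_pr f r) <= 1.
Proof.
elim: rs => [|r rs IH]; first by rewrite /= big_nil addr0 mul1r.
rewrite big_cons /=.
set a := list_mean (size rs) (fun l => (accepts (run rs l) f)%:R) in IH *.
have a0 : 0 <= a.
  by rewrite /a -(list_mean_const (size rs) 0 S_gt0) list_mean_le.
have -> : mean (fun s => list_mean (size rs) (fun l => (accepts (both (r s) (run rs l)) f)%:R))
    = (1 - reject_pr f r) * a.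
  rewrite -meanN // mulrC -meanZ; apply: eq_mean => s; rewrite mulrC -list_meanZ.
  by apply: eq_list_mean => l; rewrite accepts_both negbK -natrM mulnb.
have := reject_pr_ge0 f r; have := mean_le1 R (fun s => ~~ accepts (r s) f).
rewrite -/(reject_pr f r); move: IH.
have : 0 <= \sum_(r' <- rs) reject_pr f r' by apply: sumr_ge0 => r' _; exact: reject_pr_ge0.
move: (reject_pr f r) (\sum_(_ <- _) _) => p s s0 IH p1 p0.
have -> : (1 - p) * a * (1 + (p + s)) = a * (1 + s) - a * (p * (p + s)) by ring.
by apply: le_trans IH; rewrite gerBl mulr_ge0 // mulr_ge0 // addr_ge0.
Qed.

Lemma run_mean_cost f rs :
  list_mean (size rs) (fun l => (size (queries (run rs l) f))%:R) =
  \sum_(r <- rs) mean_cost f r.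
Proof.
elim: rs => [|r rs IH]; first by rewrite big_nil.
rewrite big_cons -IH /= /mean_cost.
rewrite -[X in _ + X](mean_const _ S_gt0) -meanD; apply: eq_mean => s.
rewrite -[X in X + _](list_mean_const (size rs) _ S_gt0) -list_meanD.
by apply: eq_list_mean => l; rewrite queries_both size_cat natrD.
Qed.

Lemma markov (T : finType) (Y : T -> nat) q :
  q%:R * mean (fun t => (q < Y t)%:R) <= mean (fun t => (Y t)%:R) :> R.
Proof.
rewrite -meanZ; apply: mean_le => t; rewrite -natrM ler_nat.
by case: (ltnP q (Y t)) => [/ltnW|_]; rewrite ?muln1 ?muln0.
Qed.

End RoundProbabilities.

(** * Rounds and their rejection probabilities *)

Section FirstHit.
Variables (R : realType) (S : finType) (cl : S -> option bool).
Hypothesis S_gt0 : (0 < #|S|)%N.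
Implicit Types (o : S) (l : seq S) (c : bool).

Fixpoint first_hit l : option bool :=
  if l is o :: l' then if cl o is Some b then Some b else first_hit l' else None.

Fixpoint scanned l : nat :=
  if l is o :: l' then if cl o is Some _ then 1%N else (scanned l').+1 else 0%N.

Lemma first_hitP l b : first_hit l = Some b -> exists o, cl o = Some b.
Proof.
elim: l => //= o l IH; case e: (cl o) => [b'|//] [<-]; by exists o.
Qed.

Definition class_pr c : R := mean (fun o => (cl o == Some c)%:R).

Definition hit_pr := class_pr true + class_pr false.

Lemma class_pr_ge0 c : 0 <= class_pr c.
Proof. exact: mean_ge0. Qed.

Lemma hit_prE : hit_pr = mean (fun o => (cl o != None)%:R).
Proof.
rewrite /hit_pr -meanD; apply: eq_mean => o.
by case: (cl o) => [[]|] /=; rewrite ?addr0 ?add0r.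
Qed.

Lemma hit_pr_le1 : hit_pr <= 1.
Proof. by rewrite hit_prE mean_le1. Qed.

Lemma mean_none (F : R) (G : S -> R) :
  mean (fun o => if cl o is Some _ then G o else F) =
  mean (fun o => if cl o is Some _ then G o else 0) + (1 - hit_pr) * F.
Proof.
rewrite hit_prE -meanN // mulrC -meanZ -meanD; apply: eq_mean => o.
by case: (cl o) => [b|] /=; rewrite ?mulr0 ?mulr1 ?addr0 ?add0r.
Qed.

(** Condition on the first sample. The factor [hit_pr] on the left keeps the identity valid when no
    sample hits. *)
Lemma first_hit_pr M c :
  hit_pr * list_mean M (fun l => (first_hit l == Some c)%:R) =
  class_pr c * (1 - (1 - hit_pr) ^+ M).
Proof.
elim: M => [|M IH] /=; first by rewrite subrr !mulr0.
set u := list_mean M _ in IH.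
have -> : mean (fun o => list_mean M (fun l =>
    ((if cl o is Some b then Some b else first_hit l) == Some c)%:R)) =
    class_pr c + (1 - hit_pr) * u.
  rewrite (_ : class_pr c = mean (fun o => if cl o is Some _ then (cl o == Some c)%:R else 0)).
    rewrite -mean_none; apply: eq_mean => o; case: (cl o) => [b|//].
    by rewrite list_mean_const.
  by apply: eq_mean => o; case: (cl o).
rewrite (_ : _ * _ = hit_pr * class_pr c + (1 - hit_pr) * (hit_pr * u)); last by ring.
by rewrite IH exprS; ring.
Qed.

Lemma mean_scanned M : hit_pr * list_mean M (fun l => (scanned l)%:R) <= 1.
Proof.
suff -> : hit_pr * list_mean M (fun l => (scanned l)%:R) = 1 - (1 - hit_pr) ^+ M.
  by rewrite gerBl exprn_ge0 // subr_ge0 hit_pr_le1.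
elim: M => [|M IH] /=; first by rewrite subrr mulr0.
have -> : mean (fun o => list_mean M (fun l =>
    (if cl o is Some _ then 1%N else (scanned l).+1)%:R)) =
    1 + (1 - hit_pr) * list_mean M (fun l => (scanned l)%:R).
  rewrite -[X in X + _](mean_const 1 S_gt0) hit_prE -meanN // mulrC -meanZ -meanD.
  apply: eq_mean => o; case: (cl o) => [b|] /=.
    by rewrite list_mean_const // mulr0 addr0.
  rewrite mulr1 -[X in X + _](list_mean_const M 1 S_gt0) -list_meanD.
  by apply: eq_list_mean => l; rewrite -nat1r.
set u := list_mean M _ in IH *.
rewrite (_ : _ * _ = hit_pr + (1 - hit_pr) * (hit_pr * u)); last by ring.
by rewrite IH exprS; ring.
Qed.

Definition opposite_hits o l :=
  if cl o is Some b then first_hit l == Some (~~ b) else false.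

(** With class probabilities p and q, two samples of opposite classes appear with probability 2pq /
    (p + q) times 1 - (1 - p - q)^M. The last factor is at least 1/2, and pq / (p + q) is at least
    half the minimum. *)
Lemma opposite_hits_pr M : (#|S| <= M)%N ->
  Num.min (class_pr true) (class_pr false) / 2 <=
  mean (fun o => list_mean M (fun l => (opposite_hits o l)%:R)).
Proof.
move=> SM; set rej := mean _.
have := first_hit_pr M false; have := first_hit_pr M true.
set ut := list_mean _ _; set uf := list_mean _ _ => ht hf.
have rejE : rej = class_pr true * uf + class_pr false * ut.
  rewrite mulrC [X in _ + X]mulrC -!meanZ -meanD; apply: eq_mean => o.
  rewrite /opposite_hits; case: (cl o) => [[]|] /=.
  - by rewrite mulr1 mulr0 addr0.
  - by rewrite mulr1 mulr0 add0r.
  - by rewrite !mulr0 addr0 list_mean_const.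
have pt := class_pr_ge0 true; have pf := class_pr_ge0 false.
have rej0 : 0 <= rej.
  by apply: mean_ge0 => o; rewrite -(list_mean_const M 0 S_gt0) list_mean_le.
case: (ltP 0 hit_pr) => [h0|h0]; last first.
  suff -> : Num.min (class_pr true) (class_pr false) = 0 by rewrite mul0r.
  have [-> ->] : class_pr true = 0 /\ class_pr false = 0.
    by rewrite /hit_pr in h0; split; lra.
  by rewrite minxx.
(* A positive [hit_pr] is at least [1 / #|S|], which is why a scan of length [#|S|] suffices. *)
have hM : 1 <= M%:R * hit_pr.
  have S0 : 0 < #|S|%:R :> R by rewrite ltr0n.
  apply: le_trans (_ : #|S|%:R * hit_pr <= _); last by rewrite ler_pM2r // ler_nat.
  have e : #|S|%:R * hit_pr = (\sum_o (cl o != None))%N%:R :> R.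
    by rewrite hit_prE /mean natr_sum mulrC divfK ?gt_eqF.
  by rewrite e ler1n -(ltr0n R) -e mulr_gt0.
have half : (1 - hit_pr) ^+ M <= 1 / 2.
  have := @bernoulli_inv R hit_pr M; rewrite ltW // hit_pr_le1 => /(_ isT) b.
  have e0 : 0 <= (1 - hit_pr) ^+ M by rewrite exprn_ge0 // subr_ge0 hit_pr_le1.
  have : (1 - hit_pr) ^+ M * 2 <= 1.
    by apply: le_trans b; apply: ler_wpM2l => //; lra.
  by lra.
have hrej : class_pr true * class_pr false <= hit_pr * rej.
  have -> : hit_pr * rej = 2 * (1 - (1 - hit_pr) ^+ M) * (class_pr true * class_pr false).
    by rewrite rejE mulrDr !(mulrCA hit_pr) ht hf; ring.
  by apply: ler_peMl; [exact: mulr_ge0 | lra].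
rewrite -(ler_pM2l h0); apply: le_trans hrej; rewrite /hit_pr.
case: (leP (class_pr true) (class_pr false)) => [h|/ltW h].
  have h' : 0 <= class_pr false - class_pr true by rewrite subr_ge0.
  by have := mulr_ge0 pt h'; lra.
have h' : 0 <= class_pr true - class_pr false by rewrite subr_ge0.
by have := mulr_ge0 pf h'; lra.
Qed.

End FirstHit.

(** * Path rounds, pairs rounds and scan rounds *)

Section Rounds.
Variables (R : realType) (n d : nat).
Notation sample := (grid n d * 'I_n)%type.
Implicit Types (f : grid n d -> R) (i : 'I_d) (o : sample) (l : seq sample)
  (qs : seq (grid n d)).

Definition probe i qs : dtree (grid n d) R :=
  ask qs (fun vs => Leaf _ _ (~~ mixed i (lookup 0 qs vs) qs)).

Lemma accepts_probe i qs f : accepts (probe i qs) f = ~~ mixed i f qs.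
Proof.
rewrite accepts_ask /= /mixed.
by rewrite (eq_rises i (lookup_map 0 f)) (eq_falls i (lookup_map 0 f)).
Qed.

Lemma queries_probe i qs f : queries (probe i qs) f = qs.
Proof. by rewrite queries_ask /= cats0. Qed.

Definition path_round i l :=
  if l is o :: _ then probe i (full_queries i o) else Leaf _ _ true.

Definition pairs_queries K i l := flatten [seq pair_queries i o | o <- take K l].

Definition pairs_round K i l := probe i (pairs_queries K i l).

Definition pair_class i f o : option bool :=
  if rises i f (pair_queries i o) then Some true
  else if falls i f (pair_queries i o) then Some false else None.

Fixpoint scan i l (k : option bool -> dtree (grid n d) R) : dtree (grid n d) R :=
  if l is o :: l' then
    ask (pair_queries i o) (fun vs =>
      if pair_class i (lookup 0 (pair_queries i o) vs) o is Some b then k (Some b)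
      else scan i l' k)
  else k None.

Definition scan_round i l :=
  if l is o :: l' then
    scan i [:: o] (fun a =>
      if a is Some b then scan i l' (fun a' => Leaf _ _ (a' != Some (~~ b)))
      else Leaf _ _ true)
  else Leaf _ _ true.

Lemma pair_class_lookup i f o :
  pair_class i (lookup 0 (pair_queries i o) (map f (pair_queries i o))) o = pair_class i f o.
Proof.
by rewrite /pair_class (eq_rises i (lookup_map 0 f)) (eq_falls i (lookup_map 0 f)).
Qed.

Lemma accepts_scan i l k f :
  accepts (scan i l k) f = accepts (k (first_hit (pair_class i f) l)) f.
Proof.
elim: l => // o l IH; rewrite [LHS]accepts_ask pair_class_lookup /=.
by case: pair_class.
Qed.

Lemma queries_scan i l k f : size (queries (scan i l k) f) =
  (2 * scanned (pair_class i f) l + size (queries (k (first_hit (pair_class i f) l)) f))%N.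
Proof.
elim: l => // o l IH.
rewrite [queries _ _]queries_ask size_cat pair_class_lookup [first_hit _ _]/= [scanned _ _]/=.
by case: pair_class => [b|] //=; rewrite IH; lia.
Qed.

Lemma accepts_scan_round i o l f :
  accepts (scan_round i (o :: l)) f = ~~ opposite_hits (pair_class i f) o l.
Proof.
rewrite accepts_scan /opposite_hits /=.
by case: (pair_class i f o) => [b|] //=; rewrite accepts_scan.
Qed.

Lemma size_queries_scan_round i o l f : size (queries (scan_round i (o :: l)) f) =
  (2 + 2 * (if pair_class i f o is Some _ then scanned (pair_class i f) l else 0))%N.
Proof.
rewrite queries_scan /=; case: (pair_class i f o) => [b|] /=; last by lia.
by rewrite queries_scan /=; lia.
Qed.

Lemma rises_class i f o : rises i f (pair_queries i o) = (pair_class i f o == Some true).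
Proof. by rewrite /pair_class; case: (rises i f _) => //; case: (falls i f _). Qed.

Lemma pair_not_mixed i f o : ~~ mixed i f (pair_queries i o).
Proof.
case: o => x w; apply/negP => /andP[].
have e : pair_queries i (x, w) = map (upd x i) [:: x i; w] by rewrite /= upd_id.
rewrite /falls e !rises_map /line_rises /= !ltnn !orbF /=.
rewrite !ltrN2; case: ltngtP => //= _; rewrite ?orbF.
  by move=> /lt_trans h /h; rewrite ltxx.
by move=> /lt_trans h /h; rewrite ltxx.
Qed.

Lemma falls_class i f o : falls i f (pair_queries i o) = (pair_class i f o == Some false).
Proof.
have := pair_not_mixed i f o; rewrite /pair_class /mixed.
by case: (rises i f _) => //=; case: (falls i f _).
Qed.

(** A rejection exhibits a rising and a falling pair in direction [i]; their union would be
    mixed. *)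
Lemma unate_scan_round i f l : unate f -> accepts (scan_round i l) f.
Proof.
case: l => // o l uf; rewrite accepts_scan_round /opposite_hits.
case e: (pair_class i f o) => [b|//]; apply/eqP => /first_hitP[o' e'].
have /negP[] := unate_not_mixed i (pair_queries i o ++ pair_queries i o') uf.
have sl qs qs' : {subset qs <= qs ++ qs'} by move=> x xq; rewrite mem_cat xq.
have sr qs qs' : {subset qs' <= qs ++ qs'} by move=> x xq; rewrite mem_cat xq orbT.
case: b e e' => e e'; apply/andP; split.
- by apply: (rises_sub (sl _ _)); rewrite rises_class e.
- by apply: (rises_sub (sr _ _)); rewrite -/(falls i f _) falls_class e'.
- by apply: (rises_sub (sr _ _)); rewrite rises_class e'.
- by apply: (rises_sub (sl _ _)); rewrite -/(falls i f _) falls_class e.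
Qed.

Definition mixed_pr f i : R := mean (fun o => (mixed i f (full_queries i o))%:R).
Definition rise_pr f i : R := mean (fun o => (rises i f (pair_queries i o))%:R).
Definition fall_pr f i : R := mean (fun o => (falls i f (pair_queries i o))%:R).
Definition minor_pr f i : R := Num.min (rise_pr f i) (fall_pr f i).

Lemma hdist_card f (g : grid n d -> R) : hdist f g = #|[set x | f x != g x]|.
Proof. by rewrite -sum1dep_card [RHS]big_mkcond. Qed.

Lemma far_from_unate_pr eps f : (0 < n)%N -> far_from_unate eps f ->
  eps / 16 <= \sum_i (mixed_pr f i + minor_pr f i).
Proof.
move=> n0 far; have [g gu gd] := unate_correction f n0.
have N0 : 0 < #|{: grid n d}|%:R :> R.
  by rewrite ltr0n; apply/card_gt0P; exists [ffun=> Ordinal n0].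
have n0R : 0 < n%:R :> R by rewrite ltr0n.
have S0 : 0 < #|{: sample}|%:R :> R by rewrite card_prod card_ord natrM mulr_gt0.
have countE P : (count_samples P)%:R = #|{: sample}|%:R * mean (fun o => (P o)%:R) :> R.
  by rewrite /mean mulrC divfK ?gt_eqF // natr_sum.
have : n%:R * (hdist f g)%:R <= 16 * (#|{: sample}|%:R *
    \sum_i (mixed_pr f i + minor_pr f i)).
  rewrite -natrM; apply: le_trans (_ : (16 * _)%:R <= _); first by rewrite ler_nat; exact: gd.
  rewrite natrM ler_pM2l // natr_sum mulr_sumr ler_sum // => i _.
  rewrite natrD countE mulrDr lerD2l /minor_pr /minn.
  by case: ifP => h; rewrite countE ler_pM2l // /rise_pr /fall_pr le_min lexx /=;
    rewrite -(ler_pM2l S0) -!countE ler_nat; lia.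
rewrite hdist_card; have := far g gu; rewrite /hamming_dist ler_pdivlMr // => fg.
rewrite card_prod card_ord natrM (mulrC #|_|%:R) -!mulrA mulrCA ler_pM2l // => h.
have := le_trans fg h; rewrite (mulrCA 16) mulrC ler_pM2l // => le16.
by rewrite ler_pdivrMr // mulrC.
Qed.

Section Reject.
Variable M : nat.
Hypotheses (n_gt0 : (0 < n)%N) (d_gt0 : (0 < d)%N).
Notation seeds := ('I_d * M.-tuple sample)%type.

Lemma card_sample : (0 < #|{: sample}|)%N.
Proof.
apply/card_gt0P; exists ([ffun=> Ordinal n_gt0], Ordinal n_gt0); exact: isT.
Qed.

Lemma card_dim : (0 < #|'I_d|)%N.
Proof. by rewrite card_ord. Qed.

Inductive round := PathRound | PairsRound of nat | ScanRound.

(** All kinds of rounds share one seed type, a direction with [M] samples, and each reads only the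
    samples it needs. *)
Definition exec (rd : round) (s : seeds) : dtree (grid n d) R :=
  match rd with
  | PathRound => path_round s.1 s.2
  | PairsRound K => pairs_round K s.1 s.2
  | ScanRound => scan_round s.1 s.2
  end.

Lemma unate_exec rd s f : unate f -> accepts (exec rd s) f.
Proof.
case: rd => [|K|] uf /=; last exact: unate_scan_round.
  by rewrite /path_round; case: (tval _) => // o l; rewrite accepts_probe unate_not_mixed.
by rewrite accepts_probe unate_not_mixed.
Qed.

Lemma mean_seeds (F : 'I_d -> seq sample -> R) :
  mean (fun s : seeds => F s.1 s.2) = mean (fun i => list_mean M (F i)).
Proof. by rewrite mean_pair; apply: eq_mean => i; rewrite -mean_tuple. Qed.

Lemma path_reject_pr f : (0 < M)%N ->
  reject_pr R f (exec PathRound) = mean (mixed_pr f).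
Proof.
move=> M0; rewrite /reject_pr (mean_seeds (fun i l => (~~ accepts (path_round i l) f)%:R)).
apply: eq_mean => i; case: M M0 => // M' _; apply: eq_mean => o.
rewrite -[RHS](list_mean_const M' _ card_sample).
by apply: eq_list_mean => l; rewrite [accepts _ _]accepts_probe negbK.
Qed.

Lemma has_rises_pairs K i f l :
  has (fun o => rises i f (pair_queries i o)) (take K l) -> rises i f (pairs_queries K i l).
Proof.
move=> /hasP[o ol]; apply: rises_sub => x xo.
by apply/flatten_mapP; exists o.
Qed.

(** If [K] times the smaller probability is at least 3, then by [bernoulli_inv] rises, and likewise
    falls, are absent from [K] pairs with probability at most 1/4; a union bound leaves 1/2. *)
Lemma pairs_reject_pr f K : (K <= M)%N ->
  mean (fun i => (3 <= K%:R * minor_pr f i)%R%:R / 2) <= reject_pr R f (exec (PairsRound K)).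
Proof.
move=> KM; rewrite /reject_pr (mean_seeds (fun i l => (~~ accepts (pairs_round K i l) f)%:R)).
apply: mean_le => i.
have r0 : 0 <= rise_pr f i <= 1 by rewrite mean_ge0 // mean_le1.
have f0 : 0 <= fall_pr f i <= 1 by rewrite mean_ge0 // mean_le1.
case: (leP 3 (K%:R * minor_pr f i)) => [h|_]; last first.
  by rewrite mul0r -(list_mean_const M 0 card_sample) list_mean_le.
have small p : 0 <= p <= 1 -> minor_pr f i <= p -> (1 - p) ^+ K <= 1 / 4.
  move=> /[dup] /andP[p0 p1] /bernoulli_inv => /(_ K) b mp.
  have e0 : 0 <= (1 - p) ^+ K by rewrite exprn_ge0 // subr_ge0.
  have hp : 3 <= K%:R * p by apply: le_trans h _; rewrite ler_wpM2l.
  have : (1 - p) ^+ K * 4 <= 1 by apply: le_trans b; rewrite ler_wpM2l //; lra.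
  by lra.
have sr : (1 - rise_pr f i) ^+ K <= 1 / 4 by apply: small; rewrite // ge_min lexx.
have sf : (1 - fall_pr f i) ^+ K <= 1 / 4 by apply: small; rewrite // ge_min lexx orbT.
have : list_mean M (fun _ : seq sample => 1) <=
   list_mean M (fun l => (~~ accepts (pairs_round K i l) f)%:R)
   + (1 - rise_pr f i) ^+ K + (1 - fall_pr f i) ^+ K.
  rewrite -(list_mean_take_none R (fun o => rises i f (pair_queries i o)) card_sample KM).
  rewrite -(list_mean_take_none R (fun o => falls i f (pair_queries i o)) card_sample KM).
  rewrite -!list_meanD.
  apply: list_mean_le => l; rewrite accepts_probe negbK /mixed.
  case: (boolP (has _ _)) => [/has_rises_pairs->|_]; last first.
    by rewrite addrAC lerDr addr_ge0.
  case: (boolP (has _ _)) => [/has_rises_pairs|_]; last by rewrite lerDr addr_ge0.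
  by rewrite -/(falls i f _) => ->; rewrite !addr0.
by rewrite list_mean_const ?card_sample // [nat_of_bool true]/=; lra.
Qed.

End Reject.

Lemma scan_reject_pr M f : (0 < n)%N -> (#|{: sample}| <= M)%N ->
  mean (fun i => minor_pr f i / 2) <= reject_pr R f (exec (M := M.+1) ScanRound).
Proof.
move=> n0 SM; have S0 := card_sample n0.
rewrite /reject_pr (mean_seeds _ (fun i l => (~~ accepts (scan_round i l) f)%:R)).
apply: mean_le => i.
have -> : minor_pr f i =
    Num.min (class_pr R (pair_class i f) true) (class_pr R (pair_class i f) false).
  by congr Num.min; apply: eq_mean => o; rewrite ?rises_class ?falls_class.
apply: le_trans (opposite_hits_pr R (pair_class i f) S0 SM) _.
apply: mean_le => o; apply: list_mean_le => l.
by rewrite [accepts _ _]accepts_scan_round negbK.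
Qed.

(** The scan is entered with probability [hit_pr] and, by [mean_scanned], its mean length times
    [hit_pr] is at most 1. So the first pair and the scan each contribute at most two queries on
    average. *)
Lemma scan_mean_cost M f : (0 < n)%N -> (0 < d)%N ->
  mean_cost R f (exec (M := M.+1) ScanRound) <= 4.
Proof.
move=> n0 d0; have S0 := card_sample n0.
rewrite /mean_cost (mean_seeds _ (fun i l => (size (queries (scan_round i l) f))%:R)).
rewrite -[leRHS](mean_const _ (card_dim d0)); apply: mean_le => i.
have h := mean_scanned R (pair_class i f) S0 M.
apply: le_trans (_ : 2 + 2 * (hit_pr R (pair_class i f) *
    list_mean M (fun l => (scanned (pair_class i f) l)%:R)) <= _); last by lra.
set u := list_mean M _; pose hit o : R := (pair_class i f o != None)%:R.
have -> : 2 + 2 * (hit_pr R (pair_class i f) * u) = mean (fun o => 2 + 2 * u * hit o).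
  by rewrite meanD mean_const // meanZ hit_prE; ring.
apply: mean_le => o.
have -> : 2 + 2 * u * hit o =
    list_mean M (fun l => 2 + 2 * hit o * (scanned (pair_class i f) l)%:R).
  by rewrite list_meanD list_mean_const // list_meanZ -/u; ring.
apply: list_mean_le => l; rewrite [size _]size_queries_scan_round /hit.
by case: (pair_class i f o) => [b|] /=; rewrite ?mulr1 ?mulr0 ?mul0r natrD ?natrM ?addr0.
Qed.

End Rounds.

(** * Schedules of rounds *)

Section UniformTester.
Variables (R : realType) (n d : nat) (S : finType).
Hypothesis S_gt0 : (0 < #|S|)%N.
Variable algo : S -> dtree (grid n d) R.

Lemma uniform_weight_ge0 (s : S) : 0 <= #|S|%:R^-1 :> R.
Proof. by rewrite invr_ge0. Qed.

Lemma uniform_weight_sum1 : \sum_(s : S) #|S|%:R^-1 = 1 :> R.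
Proof. by rewrite sumr_const -[X in X = _]mulr_natr mulVf // pnatr_eq0 -lt0n. Qed.

Definition uniform_tester := Tester uniform_weight_ge0 uniform_weight_sum1 algo.

Lemma pr_uniform (P : pred S) : pr (T := uniform_tester) P = mean (fun s => (P s)%:R).
Proof.
rewrite /pr /mean big_mkcond mulr_suml; apply: eq_bigr => s _ /=.
by case: (P s); rewrite ?mul1r ?mul0r.
Qed.

End UniformTester.

Lemma one_sided_tester (R : realType) n d (T : tester R n d) eps : one_sided_error T ->
  (forall f, far_from_unate eps f ->
     2 / 3 <= pr (fun s : seed T => ~~ accepts (algo s) f)) ->
  unateness_tester eps T.
Proof.
move=> os rej; split=> // f uf; rewrite /pr.
rewrite (eq_bigl xpredT) => [|s]; last exact: os.
by rewrite weight_sum1; lra.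
Qed.

Lemma sum_nseq (V : nmodType) (T : Type) (F : T -> V) k a :
  \sum_(x <- nseq k a) F x = F a *+ k.
Proof. by rewrite big_nseq iter_addr addr0. Qed.

Lemma sum_nseq_nat (T : Type) (F : T -> nat) k a :
  (\sum_(x <- nseq k a) F x = F a * k)%N.
Proof. by rewrite big_nseq iter_addn_0. Qed.

Lemma mean_sum (R : realType) (A : finType) (I : Type) (r : seq I) (F : I -> A -> R) :
  mean (fun a => \sum_(k <- r) F k a) = \sum_(k <- r) mean (F k).
Proof. by rewrite /mean exchange_big mulr_suml. Qed.

(** Passing from [g] to [g.+1] doubles both the old sum and [2 ^+ g * m - 1], which leaves a deficit
    of 1. The new scale supplies 2 if it counts; otherwise the left side is negative. *)
Lemma levin_sum (R : realFieldType) g (m : R) : m <= 1 ->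
  2 ^+ g * m - 1 <= \sum_(0 <= r < g.+1) 2 * 2 ^+ (g - r) * (1 <= 2 ^+ r * m)%R%:R.
Proof.
move=> m1; elim: g => [|g IH].
  rewrite big_nat1 expr0 !mul1r mulr1; apply: le_trans (_ : 0 <= _); first by lra.
  by rewrite mulr_ge0.
rewrite big_nat_recr //= subnn expr0.
have -> : \sum_(0 <= r < g.+1) 2 * 2 ^+ (g.+1 - r) * (1 <= 2 ^+ r * m)%R%:R =
    2 * \sum_(0 <= r < g.+1) 2 * 2 ^+ (g - r) * (1 <= 2 ^+ r * m)%R%:R :> R.
  rewrite mulr_sumr [LHS]big_nat [RHS]big_nat; apply: eq_bigr => r /andP[_ rg].
  by rewrite subSn // exprS !mulrA.
have : 0 <= \sum_(0 <= r < g.+1) 2 * 2 ^+ (g - r) * (1 <= 2 ^+ r * m)%R%:R :> R.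
  by apply: sumr_ge0 => r _; rewrite !mulr_ge0 // exprn_ge0.
by case: (leP 1 (2 ^+ g.+1 * m)) => h /=; rewrite exprS in h *; lra.
Qed.

(** * Running schedules and the Levin schedule *)

Section Schedules.
Variables (R : realType) (n d : nat).
Hypotheses (n_gt0 : (0 < n)%N) (d_gt0 : (0 < d)%N).
Notation sample := (grid n d * 'I_n)%type.
Implicit Types (f : grid n d -> R) (ks : seq round).

Definition seeds M := ('I_d * M.-tuple sample)%type.

Definition run_schedule M ks (l : seq (seeds M)) : dtree (grid n d) R :=
  run (map (@exec R n d M) ks) l.

Lemma card_seeds M : (0 < #|{: seeds M}|)%N.
Proof. by rewrite card_prod card_ord card_tuple muln_gt0 d_gt0 expn_gt0 card_sample. Qed.

Lemma unate_run_schedule M ks (l : seq (seeds M)) f :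
  unate f -> accepts (run_schedule ks l) f.
Proof.
move=> uf; elim: ks l => [|k ks IH] [|s l] //=.
by rewrite accepts_both unate_exec // IH.
Qed.

Definition nonadaptive_round k := if k is ScanRound then false else true.

Definition round_cost k :=
  match k with
  | PathRound => (2 * depth n + 3)%N
  | PairsRound K => (2 * K)%N
  | ScanRound => 4%N
  end.

Lemma size_pairs_queries K i (l : seq sample) : (size (pairs_queries K i l) <= 2 * K)%N.
Proof.
rewrite size_flatten sumnE !big_map (eq_bigr (fun=> 2%N)) // big_const_seq count_predT.
rewrite iter_addn addn0.
by rewrite leq_mul2l size_take_min geq_minl.
Qed.

Lemma queries_nonadaptive_round M k (s : seeds M) : nonadaptive_round k ->
  exists2 qs, (size qs <= round_cost k)%N & forall f, queries (exec R k s) f = qs.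
Proof.
case: k => [|K|] //= _.
  case: (tval s.2) => [|o l]; first by exists [::].
  exists (full_queries s.1 o); first by rewrite size_full_queries.
  by move=> f; exact: queries_probe.
exists (pairs_queries K s.1 s.2); first exact: size_pairs_queries.
by move=> f; rewrite queries_probe.
Qed.

Lemma queries_nonadaptive_schedule M ks (l : seq (seeds M)) : all nonadaptive_round ks ->
  exists2 qs, (size qs <= \sum_(k <- ks) round_cost k)%N &
    forall f, queries (run_schedule ks l) f = qs.
Proof.
elim: ks l => [|k ks IH] l /=; first by exists [::].
move=> /andP[kn /IH{}IH]; case: l => [|s l]; first by exists [::].
have [qs qss qsE] := queries_nonadaptive_round s kn.
have [qs' qss' qsE'] := IH l.
exists (qs ++ qs'); first by rewrite big_cons size_cat leq_add.
by move=> f; rewrite [queries _ _]queries_both qsE qsE'.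
Qed.

Lemma mean_cost_le M k f : mean_cost R f (exec R (M := M.+1) k) <= (round_cost k)%:R.
Proof.
case: (boolP (nonadaptive_round k)) => [kn|]; last first.
  by case: k => // _; apply: scan_mean_cost.
rewrite -[leRHS](mean_const _ (card_seeds M.+1)); apply: mean_le => s.
by have [qs qss ->] := queries_nonadaptive_round s kn; rewrite ler_nat.
Qed.

(** The sum over directions is at least [eps / 16]; averaging divides it by [d], and 64 = 4 * 16. *)
Lemma mean_dim_ge eps f (G : R) : far_from_unate eps f ->
  0 < eps -> 64 * (d%:R / eps) <= G -> 4 <= mean (fun i => G * (mixed_pr f i + minor_pr f i)).
Proof.
move=> far eps0 hG; have := far_from_unate_pr n_gt0 far.
rewrite meanZ /mean card_ord; set s := \sum_i _ => hs.
have d0 : 0 < d%:R :> R by rewrite ltr0n.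
have G0 : 0 <= G by apply: le_trans hG; rewrite mulr_ge0 // divr_ge0 // ltW.
rewrite mulrA ler_pdivlMr //.
apply: le_trans (_ : 64 * (d%:R / eps) * (eps / 16) <= _).
  by rewrite le_eqVlt; apply/orP; left; apply/eqP; field; rewrite gt_eqF.
by apply: ler_pM => //; last (by rewrite divr_ge0 // ltW); rewrite mulr_ge0 // divr_ge0 // ltW.
Qed.

Lemma minor_pr_le1 f i : minor_pr f i <= 1.
Proof. by rewrite ge_min mean_le1. Qed.

(* [3 * 2 ^ r] pairs both rise and fall with probability at least 1/2 as soon
   as [2 ^ r * minor_pr >= 1]. *)
Definition levin_schedule g :=
  nseq (2 ^ g) PathRound ++
  flatten [seq nseq (4 * 2 ^ (g - r)) (PairsRound (3 * 2 ^ r)) | r <- index_iota 0 g.+1].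

Lemma levin_reject g eps f : far_from_unate eps f -> 0 < eps ->
  64 * (d%:R / eps) <= 2 ^+ g ->
  3 <= \sum_(k <- levin_schedule g) reject_pr R f (exec R (M := 3 * 2 ^ g) k).
Proof.
move=> far eps0 hg; have M0 : (0 < 3 * 2 ^ g)%N by rewrite muln_gt0 expn_gt0.
have mG := mean_dim_ge far eps0 hg.
rewrite big_cat big_flatten big_map sum_nseq path_reject_pr //= -[_ *+ (2 ^ g)%N]mulr_natl natrX.
(* At scale [r], [4 * 2 ^ (g - r)] rounds each reject with probability at least 1/2 when the scale
   counts, whence the coefficient [2 * 2 ^+ (g - r)]. The loss of 1 in [levin_sum] turns 4 into
   3. *)
apply: le_trans (_ : 2 ^+ g * mean (mixed_pr f) + mean (fun i =>
    \sum_(0 <= r < g.+1) 2 * 2 ^+ (g - r) * (1 <= 2 ^+ r * minor_pr f i)%R%:R) <= _).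
  rewrite -meanZ -meanD -[X in X <= _](_ : 4 - 1 = _); last by lra.
  rewrite lerBlDr; apply: le_trans mG _.
  rewrite -[X in _ <= _ + X](mean_const 1 (card_dim d_gt0)) -meanD; apply: mean_le => i.
  by have := levin_sum g (minor_pr_le1 f i); lra.
rewrite lerD2l mean_sum [leLHS]big_nat [leRHS]big_nat ler_sum // => r /andP[_ rg].
rewrite sum_nseq -[leRHS]mulr_natl natrM natrX.
have rM : (3 * 2 ^ r <= 3 * 2 ^ g)%N by rewrite leq_mul2l leq_exp2l.
have c0 : 0 <= 4 * 2 ^+ (g - r) :> R by rewrite mulr_ge0 // exprn_ge0.
apply: le_trans (ler_wpM2l c0 (pairs_reject_pr n_gt0 f rM)).
rewrite -meanZ; apply: mean_le => i.
have -> : (3 <= (3 * 2 ^ r)%:R * minor_pr f i)%R = (1 <= 2 ^+ r * minor_pr f i)%R.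
  by rewrite natrM natrX -mulrA -{1}[3]mulr1 ler_pM2l.
by lra.
Qed.

Lemma all_nonadaptive_levin g : all nonadaptive_round (levin_schedule g).
Proof.
rewrite all_cat all_nseq orbT andTb; elim: (index_iota 0 g.+1) => //= r s IH.
by rewrite all_cat all_nseq orbT.
Qed.

(** Every scale costs the same: fewer rounds exactly compensate for more pairs, giving
    [24 * 2 ^ g]. *)
Lemma levin_cost g : (\sum_(k <- levin_schedule g) round_cost k =
  2 ^ g * (2 * depth n + 3) + 24 * 2 ^ g * g.+1)%N.
Proof.
rewrite big_cat big_flatten big_map sum_nseq_nat mulnC; congr (_ + _)%N.
rewrite big_nat (eq_bigr (fun=> 24 * 2 ^ g)%N) => [|r /andP[_ rg]].
  by rewrite -big_nat sum_nat_const_nat subn0 mulnC.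
rewrite sum_nseq_nat /=.
have -> : (2 ^ g = 2 ^ r * 2 ^ (g - r))%N by rewrite -expnD subnKC.
by move: (2 ^ r)%N (2 ^ (g - r))%N; clear; lia.
Qed.

Lemma accept_pr_le M ks (B : nat) f :
  B%:R <= \sum_(k <- ks) reject_pr R f (exec R (M := M) k) ->
  mean (fun s : (size ks).-tuple (seeds M) => (accepts (run_schedule ks s) f)%:R)
    * B.+1%:R <= 1 :> R.
Proof.
move=> h; have := run_accept_pr R (card_seeds M) f (map (@exec R n d M) ks).
rewrite big_map size_map; apply: le_trans.
rewrite -mean_tuple; apply: ler_wpM2l; last by rewrite -nat1r lerD2l.
exact: mean_ge0.
Qed.

End Schedules.

(** * The testers *)

Section Testers.
Variables (R : realType) (n d : nat).
Hypotheses (n_gt0 : (0 < n)%N) (d_gt0 : (0 < d)%N).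
Notation sample := (grid n d * 'I_n)%type.

Lemma card_seed_tuple T M : (0 < #|{: T.-tuple (seeds n d M)}|)%N.
Proof. by rewrite card_tuple expn_gt0 card_seeds. Qed.

Definition levin_tester g : tester R n d :=
  uniform_tester (card_seed_tuple (size (levin_schedule g)) (3 * 2 ^ g))
    (fun s => run_schedule R (levin_schedule g) s).

Lemma levin_tester_correct eps g : 0 < eps -> 64 * (d%:R / eps) <= 2 ^+ g :> R ->
  [/\ unateness_tester eps (levin_tester g), one_sided_error (levin_tester g),
      nonadaptive (levin_tester g) &
      query_bound (levin_tester g)
        (2 ^ g * (2 * depth n + 3) + 24 * 2 ^ g * g.+1)%N%:R].
Proof.
move=> eps0 hg.
have os : one_sided_error (levin_tester g).
  by move=> f uf s; exact: unate_run_schedule.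
have na (s : seed (levin_tester g)) :=
  @queries_nonadaptive_schedule R n d (3 * 2 ^ g) _ s (all_nonadaptive_levin g).
split=> //.
- apply: one_sided_tester os _ => f far.
  rewrite pr_uniform meanN ?card_seed_tuple //.
  have h2 : 2%:R <= \sum_(k <- levin_schedule g) reject_pr R f (exec R (M := 3 * 2 ^ g) k).
    by apply: le_trans (levin_reject n_gt0 d_gt0 far eps0 hg); lra.
  have := accept_pr_le n_gt0 d_gt0 h2.
  by set a := mean _ => ha; rewrite -/a; lra.
- by move=> s; have [qs _ qsE] := na s; exists qs.
- move=> s f; have [qs qss qsE] := na s.
  by rewrite [queries _ _]qsE ler_nat -levin_cost.
Qed.

(** Scan rounds are twice as many because each guarantees only half of [minor_pr]. Both kinds then
    weigh [3 * G], and the rejection probabilities sum to at least 12, more than the 9 used. *)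
Definition scan_schedule G := nseq (3 * G) PathRound ++ nseq (6 * G) ScanRound.

(* Ten times the expected cost, for Markov's inequality. *)
Definition scan_budget G := (10 * (3 * G * (2 * depth n + 3) + 24 * G))%N.

Definition scan_tester G : tester R n d :=
  uniform_tester (card_seed_tuple (size (scan_schedule G)) #|{: sample}|.+1)
    (fun s => cut (scan_budget G) (run_schedule R (scan_schedule G) s)).

Lemma scan_reject G eps (f : grid n d -> R) : far_from_unate eps f -> 0 < eps ->
  64 * (d%:R / eps) <= G%:R ->
  9 <= \sum_(k <- scan_schedule G) reject_pr R f (exec R (M := #|{: sample}|.+1) k).
Proof.
move=> far eps0 hG; have mG := mean_dim_ge n_gt0 d_gt0 far eps0 hG.
rewrite big_cat !sum_nseq path_reject_pr //=.
apply: le_trans (_ : mean (mixed_pr f) *+ (3 * G) +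
   mean (fun i => minor_pr f i / 2) *+ (6 * G) <= _); last first.
  by rewrite lerD2l lerMn2r scan_reject_pr // orbT.
rewrite meanZ (meanD (mixed_pr f)) in mG.
have -> : mean (fun i => minor_pr f i / 2) = mean (minor_pr f) / 2.
  by rewrite mulrC -meanZ; apply: eq_mean => i; rewrite mulrC.
rewrite -[X in X + _]mulr_natl -[X in _ + X]mulr_natl !natrM; lra.
Qed.

(** On a far input the uncut run accepts with probability at most 1/10, and the budget is exceeded
    with probability at most 1/10. Hence the cut run accepts with probability at most 1/5. *)
Lemma scan_tester_correct eps G : (0 < G)%N -> 0 < eps ->
  64 * (d%:R / eps) <= G%:R :> R ->
  [/\ unateness_tester eps (scan_tester G), one_sided_error (scan_tester G) &
      query_bound (scan_tester G) (scan_budget G)%:R].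
Proof.
move=> G0 eps0 hG.
have os : one_sided_error (scan_tester G).
  by move=> f uf s; apply: accepts_cut; exact: unate_run_schedule.
split=> //; last by move=> s f; rewrite ler_nat size_queries_cut.
apply: one_sided_tester os _ => f far.
rewrite pr_uniform meanN ?card_seed_tuple //=.
have h9 : 9%:R <= \sum_(k <- scan_schedule G)
    reject_pr R f (exec R (M := #|{: sample}|.+1) k).
  exact: scan_reject far eps0 hG.
have := accept_pr_le n_gt0 d_gt0 h9; set a := mean _ => ha.
set Y := fun s : (size (scan_schedule G)).-tuple (seeds n d #|{: sample}|.+1) =>
  size (queries (run_schedule R (scan_schedule G) s) f).
have cost : mean (fun s => (Y s)%:R) <= (3 * G * (2 * depth n + 3) + 24 * G)%N%:R :> R.
  rewrite /Y (mean_tuple _ (fun l => (size (queries (run_schedule R (scan_schedule G) l) f))%:R)).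
  have := run_mean_cost R (card_seeds n_gt0 d_gt0 #|{: sample}|.+1) f
    (map (@exec R n d #|{: sample}|.+1) (scan_schedule G)).
  rewrite big_map size_map => ->.
  rewrite big_cat !sum_nseq natrD lerD //.
    by rewrite -[leLHS]mulr_natl [leRHS]natrM ler_wpM2l // mean_cost_le.
  apply: le_trans (_ : 4 *+ (6 * G) <= _).
    by rewrite lerMn2r -[4]/((round_cost n ScanRound)%:R) mean_cost_le // orbT.
  by rewrite -mulrnA ler_nat; lia.
have := markov R Y (scan_budget G); set p := mean _ => hp.
have acc : mean (fun s : (size (scan_schedule G)).-tuple (seeds n d #|{: sample}|.+1) =>
    (accepts (cut (scan_budget G) (run_schedule R (scan_schedule G) s)) f)%:R) <= a + p.
  rewrite -meanD; apply: mean_le => s.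
  case: (leqP (Y s) (scan_budget G)) => h; first by rewrite accepts_cut_small ?addr0.
  by apply: (@le_trans _ _ 1); [rewrite lern1 leq_b1 | rewrite lerDr].
have c0 : (0 : R) < (3 * G * (2 * depth n + 3) + 24 * G)%N%:R by rewrite ltr0n; lia.
have p1 : 10 * p <= 1.
  rewrite -(ler_pM2l c0) mulr1 (le_trans _ cost) // (le_trans _ hp) //.
  by rewrite /scan_budget natrM mulrA (mulrC 10).
by lra.
Qed.

End Testers.

(** * Logarithms and powers of two *)

Section Numerics.
Variable R : realType.

Lemma ln2_gt0 : 0 < ln 2 :> R.
Proof. by rewrite ln_gt0 // ltr1n. Qed.

Lemma ln_le (x y : R) : 0 < x -> x <= y -> ln x <= ln y.
Proof. by move=> x0 xy; rewrite ler_ln // posrE (lt_le_trans x0). Qed.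

Lemma ln_pow2 k : ln (2 ^+ k) = k%:R * ln 2 :> R.
Proof. by rewrite lnXn // mulr_natl. Qed.

Lemma power2_between (y : R) : 1 <= y -> exists g, y <= 2 ^+ g <= 2 * y.
Proof.
move=> y1; have y0 : 0 <= y by lra.
have /andP[ty yt] := truncn_itv y0.
have t0 : (0 < Num.truncn y)%N by rewrite truncn_gt0.
have /= /andP[lo hi] := trunc_log_bounds (isT : 1 < 2)%N t0.
exists (trunc_log 2 (Num.truncn y)).+1; apply/andP; split.
  by rewrite (le_trans (ltW yt)) // -natrX ler_nat.
by rewrite exprS ler_pM2l // (le_trans _ ty) // -natrX ler_nat.
Qed.

(** The extra one in [depth] is absorbed by [ln 2 <= ln n]. This fails for [n = 1], where [ln n]
    vanishes and the accepting tester is used. *)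
Lemma depth_ln n : (1 < n)%N -> (depth n)%:R * ln 2 <= 2 * ln n%:R :> R.
Proof.
move=> n1; have /= /andP[lo _] := trunc_log_bounds (isT : 1 < 2)%N (ltnW n1).
have h : (trunc_log 2 n)%:R * ln 2 <= ln n%:R :> R.
  by rewrite -ln_pow2 ln_le ?exprn_gt0 // -natrX ler_nat.
have h' : ln 2 <= ln n%:R :> R by rewrite ln_le // ler_nat.
by rewrite /depth -nat1r mulrDl mul1r; lra.
Qed.

End Numerics.

(** * Grids with a single point, and families of testers *)

Section TrivialTester.
Variables (R : realType) (d : nat).

Definition accepting_tester n : tester R n d :=
  uniform_tester (S := unit) (eq_leq (esym card_unit)) (fun=> Leaf _ _ true).

Lemma all_unate1 (f : grid 1 d -> R) : unate f.
Proof.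
move=> i; right => x y _ _; suff -> : x = y by [].
by apply/ffunP => j; rewrite !ord1.
Qed.

Lemma accepting_tester_correct eps (q : R) : 0 < eps -> 0 <= q ->
  [/\ unateness_tester eps (accepting_tester 1), one_sided_error (accepting_tester 1),
      nonadaptive (accepting_tester 1) & query_bound (accepting_tester 1) q].
Proof.
move=> eps0 q0; split=> //; last by move=> s; exists [::].
apply: one_sided_tester => // f /(_ f (all_unate1 f)).
rewrite /hamming_dist (_ : [set x | f x != f x] = set0) ?cards0 ?mul0r; last first.
  by apply/setP => x; rewrite !inE eqxx.
by rewrite leNgt eps0.
Qed.

(** Classical choice of one tester per [eps]; outside the interval the accepting tester is a
    filler. *)
Lemma choose_testers n (P : R -> tester R n d -> Prop) :
  (forall eps, 0 < eps < 1 / 2 -> exists T, P eps T) ->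
  exists T, forall eps, 0 < eps < 1 / 2 -> P eps (T eps).
Proof.
move=> ex; suff /choice[T TP] : forall eps, exists T, 0 < eps < 1 / 2 -> P eps T by exists T.
move=> eps; case: (boolP (0 < eps < 1 / 2)) => [/ex[T PT]|_]; first by exists T.
by exists (accepting_tester n).
Qed.

End TrivialTester.

(** * Explicit constants *)

Section UpperBounds.
Variable R : realType.

Lemma two_le_ratio d (eps : R) : (0 < d)%N -> 0 < eps < 1 / 2 -> 2 <= d%:R / eps.
Proof.
move=> d0 /andP[e0 e1]; rewrite ler_pdivlMr //.
by rewrite -(ler1n R) in d0; lra.
Qed.

Lemma query_bound_weaken n d (T : tester R n d) q q' :
  q <= q' -> query_bound T q -> query_bound T q'.
Proof. by move=> qq' Tq s f; exact: le_trans (Tq s f) qq'. Qed.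

Lemma nonadaptive_upper_bound n d (eps : R) : (0 < n)%N -> (0 < d)%N -> 0 < eps < 1 / 2 ->
  exists T : tester R n d,
    [/\ unateness_tester eps T, one_sided_error T, nonadaptive T &
        query_bound T (128 * 216 / ln 2 * (d%:R / eps * (ln (d%:R / eps) + ln n%:R)))].
Proof.
move=> n0 d0 he; have L0 := ln2_gt0 R.
have /andP[e0 _] := he; have hz := two_le_ratio d0 he; set z := d%:R / eps in hz *.
have lnz : ln 2 <= ln z by rewrite ln_le.
have lnn : 0 <= ln n%:R :> R by rewrite ln_ge0 // ler1n.
have z0 : 0 <= z by lra.
have q0 : 0 <= 128 * 216 / ln 2 * (z * (ln z + ln n%:R)).
  have lnz0 : 0 <= ln z by lra.
  apply: mulr_ge0; last by rewrite mulr_ge0 // addr_ge0.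
  by rewrite divr_ge0 ?mulr_ge0 // ltW.
case: (ltnP 1 n) => [n1|n1]; last first.
  have n_eq1 : n = 1%N by lia.
  subst n.
  by exists (accepting_tester R d 1); exact: (accepting_tester_correct d e0 q0).
have [|g /andP[g_lo g_hi]] := @power2_between R (64 * z); first by lra.
have [? ? ? qb] := levin_tester_correct n0 d0 e0 g_lo.
exists (levin_tester R n0 d0 g); split=> //; apply: query_bound_weaken qb.
rewrite -(ler_pM2r L0) (_ : _ * _ * ln 2 = 128 * 216 * (z * (ln z + ln n%:R))); last first.
  by field; rewrite gt_eqF.
(* From [2 ^+ g <= 2 ^+ 7 * z], [g.+1] times [ln 2] is at most [8 * ln 2 + ln z], and
   [ln 2 <= ln z]. *)
have gL : g.+1%:R * ln 2 <= 9 * ln z.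
  have : ln (2 ^+ g) <= ln (2 ^+ 7 * z) by rewrite ln_le ?exprn_gt0 //; lra.
  rewrite lnM ?posrE ?exprn_gt0 //; last by lra.
  by rewrite !ln_pow2 -nat1r; lra.
have dL := depth_ln R n1.
have nL : ln 2 <= ln n%:R :> R by rewrite ln_le // ler_nat.
rewrite natrD !natrM natrD natrM natrX.
set G := 2 ^+ g in g_lo g_hi *.
(* 216 = 24 * 9 covers the pairs rounds, while the path rounds cost at most 7 [ln n]; the factor 128
   comes from [G <= 128 * z]. *)
apply: le_trans (_ : G * (216 * (ln z + ln n%:R)) <= _); last first.
  by nra.
rewrite (_ : _ * ln 2 = G * (2 * ((depth n)%:R * ln 2) + 3 * ln 2 + 24 * (g.+1%:R * ln 2)));
  last by ring.
by apply: ler_wpM2l; lra.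
Qed.

Lemma adaptive_upper_bound n d (eps : R) : (0 < n)%N -> (0 < d)%N -> 0 < eps < 1 / 2 ->
  exists T : tester R n d,
    [/\ unateness_tester eps T, one_sided_error T &
        query_bound T (128 * 450 / ln 2 * (d%:R * ln n%:R / eps))].
Proof.
move=> n0 d0 he; have L0 := ln2_gt0 R.
have /andP[e0 _] := he; have hz := two_le_ratio d0 he.
rewrite (_ : d%:R * ln n%:R / eps = d%:R / eps * ln n%:R); last by rewrite mulrAC.
set z := d%:R / eps in hz *.
have lnn : 0 <= ln n%:R :> R by rewrite ln_ge0 // ler1n.
have q0 : 0 <= 128 * 450 / ln 2 * (z * ln n%:R).
  have z0 : 0 <= z by lra.
  by apply: mulr_ge0; [rewrite divr_ge0 ?mulr_ge0 // ltW | rewrite mulr_ge0].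
case: (ltnP 1 n) => [n1|n1]; last first.
  have n_eq1 : n = 1%N by lia.
  subst n.
  exists (accepting_tester R d 1).
  by have [] := @accepting_tester_correct R d eps _ e0 q0; split.
have [|g /andP[g_lo g_hi]] := @power2_between R (64 * z); first by lra.
rewrite -!natrX in g_lo g_hi.
have G0 : (0 < 2 ^ g)%N by rewrite expn_gt0.
have [? ? qb] := scan_tester_correct n0 d0 G0 e0 g_lo.
exists (scan_tester R n0 d0 (2 ^ g)); split=> //; apply: query_bound_weaken qb.
rewrite -(ler_pM2r L0) (_ : _ * _ * ln 2 = 128 * 450 * (z * ln n%:R)); last first.
  by field; rewrite gt_eqF.
have dL := depth_ln R n1.
have nL : ln 2 <= ln n%:R :> R by rewrite ln_le // ler_nat.
rewrite /scan_budget natrM natrD !natrM natrD natrM.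
set G := (2 ^ g)%N%:R in g_lo g_hi *.
(* The budget is [G] times 60 [depth] + 330, and 450 = 60 * 2 + 330 by [depth_ln] and
   [ln 2 <= ln n]. *)
apply: le_trans (_ : G * (450 * ln n%:R) <= _); last by nra.
rewrite (_ : _ * ln 2 = G * (60 * ((depth n)%:R * ln 2) + 330 * ln 2)); last by ring.
by apply: ler_wpM2l; lra.
Qed.

End UpperBounds.

Theorem theorem1p1 (R : realType) :
  (exists C : R, 0 < C /\
     forall n d : nat, (0 < n)%N -> (0 < d)%N ->
     exists T : R -> tester R n d, forall eps : R, 0 < eps < 1 / 2 ->
       [/\ unateness_tester eps (T eps),
           one_sided_error (T eps),
           nonadaptive (T eps) &
           query_bound (T eps)
             (C * (d%:R / eps * (ln (d%:R / eps) + ln n%:R)))])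
  /\
  (exists C : R, 0 < C /\
     forall n d : nat, (0 < n)%N -> (0 < d)%N ->
     exists T : R -> tester R n d, forall eps : R, 0 < eps < 1 / 2 ->
       [/\ unateness_tester eps (T eps),
           one_sided_error (T eps) &
           query_bound (T eps) (C * (d%:R * ln n%:R / eps))]).
Proof.
have L0 := ln2_gt0 R; split.
  exists (128 * 216 / ln 2); split; first by rewrite divr_gt0 // mulr_gt0.
  move=> n d n0 d0.
  have [T TP] := choose_testers (fun eps => @nonadaptive_upper_bound R n d eps n0 d0).
  by exists T.
exists (128 * 450 / ln 2); split; first by rewrite divr_gt0 // mulr_gt0.
move=> n d n0 d0.
have [T TP] := choose_testers (fun eps => @adaptive_upper_bound R n d eps n0 d0).
by exists T.
Qed.
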